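(* Let $\delta\in(0,1)$, $T\ge 2L+1$, and let $\mathcal{G}^\star$ be the parameter of the optimal LQG system responses (defined in the context). Let $N$ independent noisy trajectories, all generated with the same input $u_{[0,T-1]}$, be averaged to give $\bar x_{[0,T-1]}$, and let $\hat J$ be the LQG cost, on the true system, of the controller synthesized from $\{\bar x_{[0,T-1]},u_{[0,T-1]}\}$ by the robust synthesis problem (defined in the context) with $$\varepsilon=\sqrt{\frac{2\sigma^2nT}{N}\log\left(\frac{2nT}{\delta}\right)}.$$ Let $J^\star$ be the optimal LQG cost. If $$N\ge 2\sigma^2nT\log(2nT/\delta)\,\max\left\{9L\|\mathcal{G}^\star\|_2^2,\ 4\|\mathcal{G}^\star\|_2^2\,\|\mathcal{T}_{T-L+1}(I)\|_2^2\right\},$$ then, with probability at least $1-\delta$, $$\frac{\hat J-J^\star}{J^\star}\le 6\|\mathcal{G}^\star\|_2\sqrt{\frac{2\sigma^2nT}{N}\log\left(\frac{2nT}{\delta}\right)}\left(2\sqrt{L}+\|\mathcal{T}_{T-L+1}(I)\|_2\left(1+\frac{L(1+\|\mathcal{O}_L(A)\|_2)\|Q^{1/2}\|_F}{J^\star}\right)\right).$$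
   Context: System and data. $A\in\mathbb{R}^{n\times n}$, $B\in\mathbb{R}^{n\times m}$, $(A,B)$ controllable, $L>0$ the control horizon, $T$ the data length. The input $u_{[0,T-1]}$ is fixed and persistently exciting of order $n+L$. (A signal in $\mathbb{R}^p$ of length $T$ is persistently exciting of order $K$ if its Hankel matrix of order $K$ has full rank, with $T\ge(p+1)K-1$ assumed.) All trajectories start from the zero initial state. The noise-free state is $x(t+1)=Ax(t)+Bu(t)$. For $i=1,\dots,N$ the noisy states are $\tilde x^{(i)}(t+1)=A\tilde x^{(i)}(t)+Bu(t)+w^{(i)}(t)$, with $w^{(i)}(t)\sim\mathcal{N}(0,\sigma^2I_n)$ independent over $i$ and $t$ (the same input is replayed in every trajectory). The averages are $\bar x=\frac1N\sum_{i}\tilde x^{(i)}$ and $\bar w=\frac1N\sum_i w^{(i)}$, so that $\bar x(t+1)=A\bar x(t)+Bu(t)+\bar w(t)$. Notation. $\|\cdot\|_2$ is the spectral norm and $\|\cdot\|_F$ the Frobenius norm. $\mathcal{H}_L(\sigma)$ has $(k,t)$ block $\sigma(t+k)$, $0\le k\le L-1$, $0\le t\le T-L$. $\mathcal{H}_1(\sigma)=[\sigma(0)\cdots\sigma(T-L)]$ is its first block row. $\Gamma(x)=\{G\in\mathbb{R}^{(T-L+1)\times n}:\mathcal{H}_1(x)G=I_n\}$, similarly $\Gamma(\bar x)$. $\mathcal{L}_{TV}^{L,p\times q}$ is the set of $L\times L$ block-lower-triangular matrices with $p\times q$ blocks, indexed from $0$; $\hat G(i,j)$ is the $(i,j)$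 block of $\hat{\mathcal{G}}$. $\mathcal{Z}$ is the block-downshift operator ($L\times L$ blocks of size $n$ or $m$ according to dimensions, identity blocks on the first block subdiagonal, zeros elsewhere), $\mathcal{Z}_L=[\,I\ \mathcal{Z}\ \cdots\ \mathcal{Z}^{L-1}\,]$, $\mathcal{A}=I_L\otimes A$, $\mathcal{B}=I_L\otimes B$. $\mathcal{O}_L(A)=[I;A;\dots;A^{L-1}]$ (stacked vertically). $\mathcal{T}_M(I)$ is the $M\times M$ block matrix with $n\times n$ blocks whose $(i,j)$ block is $A^{i-j-1}$ if $i>j$ and $0$ otherwise. Cost. $Q\in\mathbb{R}^{n\times n}$, $R\in\mathbb{R}^{m\times m}$ symmetric positive semidefinite, $\mathcal{Q}=I_L\otimes Q$, $\mathcal{R}=I_L\otimes R$. For $\mathcal{K}\in\mathcal{L}_{TV}^{L,m\times n}$ (policy $u_{[0,L-1]}=\mathcal{K}x_{[0,L-1]}$), with $\mathbf{\Phi}_x=(I-\mathcal{Z}(\mathcal{A}+\mathcal{B}\mathcal{K}))^{-1}$ and $\mathbf{\Phi}_u=\mathcal{K}\mathbf{\Phi}_x$, the LQG cost (square and noise-variance factor dropped) is $J(\mathcal{K})=\left\|\mathrm{blkdiag}(\mathcal{Q}^{1/2},\mathcal{R}^{1/2})[\mathbf{\Phi}_x;\mathbf{\Phi}_u]\right\|_F$. Optimal parameter. The optimal LQG responses $(\mathbf{\Phi}_x^\star,\mathbf{\Phi}_u^\star)$ minimize $\left\|\mathrm{blkdiag}(\mathcal{Q}^{1/2},\mathcal{R}^{1/2})[\mathbf{\Phi}_x;\mathbf{\Phi}_u]\right\|_F$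 over $\mathbf{\Phi}_x\in\mathcal{L}_{TV}^{L,n\times n}$, $\mathbf{\Phi}_u\in\mathcal{L}_{TV}^{L,m\times n}$ subject to $[\,I-\mathcal{Z}\mathcal{A}\ \ -\mathcal{Z}\mathcal{B}\,][\mathbf{\Phi}_x;\mathbf{\Phi}_u]=I$; $J^\star=J(\mathbf{\Phi}_u^\star(\mathbf{\Phi}_x^\star)^{-1})$ is the optimal value. $\mathcal{G}^\star=\mathrm{blkdiag}(G_0^\star,\dots,G_{L-1}^\star)$, $G_k^\star\in\Gamma(x)$, satisfies $\mathbf{\Phi}_x^\star=\mathcal{Z}_L(I_L\otimes\mathcal{H}_L(x))\mathcal{G}^\star$ and $\mathbf{\Phi}_u^\star=\mathcal{Z}_L(I_L\otimes\mathcal{H}_L(u))\mathcal{G}^\star$; among all such $\mathcal{G}^\star$ one of minimum norm is selected. Robust synthesis problem (with data $\bar x,u$ and parameter $\varepsilon$): over $\gamma\in[0,1)$ and $\hat{\mathcal{G}}\in\mathcal{L}_{TV}^{L,(T-L+1)\times n}$, minimize $$\frac{1}{1-\gamma}\left\|\begin{bmatrix}\mathcal{Q}^{1/2}&\\&\mathcal{R}^{1/2}\end{bmatrix}\begin{bmatrix}\mathcal{Z}_L(I_L\otimes\mathcal{H}_L(\bar x))\\ \mathcal{Z}_L(I_L\otimes\mathcal{H}_L(u))\end{bmatrix}\hat{\mathcal{G}}\right\|_F$$ subject to $\|\hat{\mathcal{G}}\|_2\le\gamma/(\sqrt{L}\varepsilon)$, $\hat G(i,i)\in\Gamma(\bar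 x)$ for $i=0,\dots,L-1$, and $\mathcal{H}_1(\bar x)\hat G(i,j)=0$ for $i\neq j$. For an optimal solution $(\hat{\mathcal{G}},\hat\gamma)$, the synthesized controller is $\hat{\mathcal{K}}=\hat{\mathbf{\Phi}}_u\hat{\mathbf{\Phi}}_x^{-1}$ with $\hat{\mathbf{\Phi}}_x=\mathcal{Z}_L(I_L\otimes\mathcal{H}_L(\bar x))\hat{\mathcal{G}}$, $\hat{\mathbf{\Phi}}_u=\mathcal{Z}_L(I_L\otimes\mathcal{H}_L(u))\hat{\mathcal{G}}$, and $\hat J=J(\hat{\mathcal{K}})$. *)

(* Defs.v *)
(* MathComp / MathComp-Analysis, over an arbitrary realType R. *)
From HB Require Import structures.
From mathcomp Require Import all_boot all_order all_algebra.
From mathcomp Require Import all_classical all_reals all_analysis.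

Set Implicit Arguments.
Unset Strict Implicit.
Unset Printing Implicit Defensive.

Import Order.TTheory GRing.Theory Num.Theory.
Import numFieldNormedType.Exports.

Local Open Scope classical_set_scope.
Local Open Scope ring_scope.

(** * Norms and positive semidefinite square roots *)

Definition frobnorm (R : realType) (p q : nat) (M : 'M[R]_(p, q)) : R :=
  Num.sqrt (\sum_i \sum_j M i j ^+ 2).

(* On a column vector, [frobnorm] is the Euclidean norm. *)
Definition specnorm (R : realType) (p q : nat) (M : 'M[R]_(p, q)) : R :=
  sup [set frobnorm (M *m v) | v in [set v : 'cV[R]_q | frobnorm v <= 1]].

Definition psdmx (R : realType) (p : nat) (M : 'M[R]_p) : Prop :=
  M^T = M /\ forall v : 'cV[R]_p, 0 <= (v^T *m M *m v) ord0 ord0.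

(* A positive semidefinite matrix has exactly one positive semidefinite square
   root, so the choice made by [xget] is forced (the default 0 is only returned
   when M is not positive semidefinite). *)
Definition psdsqrt (R : realType) (p : nat) (M : 'M[R]_p) : 'M[R]_p :=
  xget 0 [set S : 'M[R]_p | psdmx S /\ S *m S = M].

(** * Block matrices *)

Notation "''BM[' R ]_ ( L , p , q )" :=
  ('M[R]_(\sum_(i < L) p, \sum_(j < L) q)%N)
  (at level 8, R, L, p, q at level 200, only parsing) : type_scope.

(* [mxblock] for blocks of equal sizes. *)
Definition blkmx (R : realType) (L p q : nat)
    (F : 'I_L -> 'I_L -> 'M[R]_(p, q)) : 'BM[R]_(L, p, q) :=
  @mxblock R L L (fun=> p) (fun=> q) F.

Definition blkdiag (R : realType) (L p q : nat) (D : 'I_L -> 'M[R]_(p, q)) :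
    'BM[R]_(L, p, q) :=
  blkmx (fun i j => if i == j then D i else 0).

(* I_L (x) M *)
Definition Iotimes (R : realType) (L p q : nat) (M : 'M[R]_(p, q)) :
    'BM[R]_(L, p, q) := blkdiag (fun _ : 'I_L => M).

Definition blk (R : realType) (L p q : nat) (M : 'BM[R]_(L, p, q))
    (i j : 'I_L) : 'M[R]_(p, q) :=
  @submxblock R L L (fun=> p) (fun=> q) M i j.

(* Membership in L_TV^{L, p x q}. *)
Definition blk_lower (R : realType) (L p q : nat) (M : 'BM[R]_(L, p, q)) :
    Prop :=
  forall i j : 'I_L, (i < j)%N -> blk M i j = 0.

Definition downshift (R : realType) (L p : nat) : 'BM[R]_(L, p, p) :=
  blkmx (fun i j => if i == j.+1 :> nat then 1%:M else 0).

(* Z_L = [ I  Z  ...  Z^(L-1) ] *)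
Definition downshifts (R : realType) (L p : nat) :
    'M[R]_(\sum_(i < L) p, \sum_(k < L) \sum_(i < L) p)%N :=
  \mxrow_(k < L) (downshift R L p ^+ k).

Definition obsmx (R : realType) (L n : nat) (A : 'M[R]_n) :
    'M[R]_(\sum_(k < L) n, n)%N :=
  \mxcol_(k < L) (A ^+ k).

Definition toepmx (R : realType) (M n : nat) (A : 'M[R]_n) : 'BM[R]_(M, n, n) :=
  blkmx (fun i j => if (j < i)%N then A ^+ (i - j - 1) else 0).

(** * Signals, Hankel matrices and linear systems *)

(* A signal of length T is a function on nat of which only the values at
   t < T are ever used. *)

Definition hankrow (R : realType) (p W : nat) (s : nat -> 'cV[R]_p) (k : nat) :
    'M[R]_(p, W) :=
  \matrix_(a, t) s (t + k)%N a ord0.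

(* Hankel matrix of order K of a signal of length T.  It is only meaningful
   for K <= T, where (T - K).+1 is the usual number of columns T - K + 1. *)
Definition hankel (R : realType) (p T K : nat) (s : nat -> 'cV[R]_p) :
    'M[R]_(\sum_(k < K) p, (T - K).+1)%N :=
  \mxcol_(k < K) hankrow (T - K).+1 s k.

(* First block row of the Hankel matrix of order L. *)
Definition hankel1 (R : realType) (p T L : nat) (s : nat -> 'cV[R]_p) :
    'M[R]_(p, (T - L).+1) :=
  hankrow (T - L).+1 s 0.

(* The length condition makes the Hankel matrix at least as wide as it is
   high, so that full rank means full row rank. *)
Definition persistently_exciting (R : realType) (p T K : nat)
    (s : nat -> 'cV[R]_p) : Prop :=
  ((p + 1) * K - 1 <= T)%N /\ row_free (hankel T K s).

Fixpoint state (R : realType) (n m : nat) (A : 'M[R]_n) (B : 'M[R]_(n, m))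
    (x0 : 'cV[R]_n) (u : nat -> 'cV[R]_m) (w : nat -> 'cV[R]_n) (t : nat) :
    'cV[R]_n :=
  if t is s.+1 then A *m state A B x0 u w s + B *m u s + w s else x0.

Definition controllable (R : realType) (n m : nat) (A : 'M[R]_n)
    (B : 'M[R]_(n, m)) : Prop :=
  forall x0 x1 : 'cV[R]_n, exists (t : nat) (u : nat -> 'cV[R]_m),
    state A B x0 u (fun=> 0) t = x1.

(* G \in Gamma(x) *)
Definition in_Gamma (R : realType) (n T L : nat) (x : nat -> 'cV[R]_n)
    (G : 'M[R]_((T - L).+1, n)) : Prop :=
  hankel1 T L x *m G = 1%:M.

(** * System level responses and the LQG cost *)

(* || blkdiag(calQ^(1/2), calR^(1/2)) [Phix; Phiu] ||_F *)
Definition response_cost (R : realType) (L n m : nat) (Q : 'M[R]_n)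
    (Rm : 'M[R]_m) (Phix : 'BM[R]_(L, n, n)) (Phiu : 'BM[R]_(L, m, n)) : R :=
  frobnorm (block_mx (psdsqrt (Iotimes L Q)) 0 0 (psdsqrt (Iotimes L Rm))
            *m col_mx Phix Phiu).

(* invmx is a genuine inverse here when K is block lower triangular, as the
   matrix is then the identity minus a strictly lower triangular one. *)
Definition closed_loop (R : realType) (L n m : nat) (A : 'M[R]_n)
    (B : 'M[R]_(n, m)) (K : 'BM[R]_(L, m, n)) : 'BM[R]_(L, n, n) :=
  invmx (1%:M - downshift R L n *m (Iotimes L A + Iotimes L B *m K)).

Definition LQG_cost (R : realType) (L n m : nat) (A : 'M[R]_n)
    (B : 'M[R]_(n, m)) (Q : 'M[R]_n) (Rm : 'M[R]_m) (K : 'BM[R]_(L, m, n)) : R :=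
  response_cost Q Rm (closed_loop A B K) (K *m closed_loop A B K).

Definition achievable (R : realType) (L n m : nat) (A : 'M[R]_n)
    (B : 'M[R]_(n, m)) (Phix : 'BM[R]_(L, n, n)) (Phiu : 'BM[R]_(L, m, n)) :
    Prop :=
  [/\ blk_lower Phix, blk_lower Phiu &
      row_mx (1%:M - downshift R L n *m Iotimes L A)
             (- (downshift R L n *m Iotimes L B)) *m col_mx Phix Phiu = 1%:M].

Definition optimal_response (R : realType) (L n m : nat) (A : 'M[R]_n)
    (B : 'M[R]_(n, m)) (Q : 'M[R]_n) (Rm : 'M[R]_m)
    (Phix : 'BM[R]_(L, n, n)) (Phiu : 'BM[R]_(L, m, n)) : Prop :=
  achievable A B Phix Phiu /\
  forall (Psix : 'BM[R]_(L, n, n)) (Psiu : 'BM[R]_(L, m, n)),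
    achievable A B Psix Psiu ->
    response_cost Q Rm Phix Phiu <= response_cost Q Rm Psix Psiu.

(* Z_L (I_L (x) H_L(s)) G *)
Definition data_response (R : realType) (L p n T : nat) (s : nat -> 'cV[R]_p)
    (G : 'BM[R]_(L, (T - L).+1, n)) : 'BM[R]_(L, p, n) :=
  downshifts R L p *m Iotimes L (hankel T L s) *m G.

Definition parametrizes (R : realType) (L n m T : nat)
    (x : nat -> 'cV[R]_n) (u : nat -> 'cV[R]_m)
    (Phix : 'BM[R]_(L, n, n)) (Phiu : 'BM[R]_(L, m, n))
    (G : 'I_L -> 'M[R]_((T - L).+1, n)) : Prop :=
  [/\ forall k, in_Gamma x (G k),
      Phix = data_response x (blkdiag G) & Phiu = data_response u (blkdiag G)].

(* The parameter of a given response, of minimum spectral norm. *)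
Definition minimal_parameter (R : realType) (L n m T : nat)
    (x : nat -> 'cV[R]_n) (u : nat -> 'cV[R]_m)
    (Phix : 'BM[R]_(L, n, n)) (Phiu : 'BM[R]_(L, m, n))
    (G : 'I_L -> 'M[R]_((T - L).+1, n)) : Prop :=
  parametrizes x u Phix Phiu G /\
  forall G' : 'I_L -> 'M[R]_((T - L).+1, n), parametrizes x u Phix Phiu G' ->
    specnorm (blkdiag G) <= specnorm (blkdiag G').

(** * Robust synthesis *)

Definition robust_feasible (R : realType) (L n T : nat)
    (x : nat -> 'cV[R]_n) (eps : R)
    (gam : R) (G : 'BM[R]_(L, (T - L).+1, n)) : Prop :=
  [/\ 0 <= gam < 1, blk_lower G,
      specnorm G <= gam / (Num.sqrt L%:R * eps),
      forall i : 'I_L, in_Gamma x (blk G i i) &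
      forall i j : 'I_L, i != j -> hankel1 T L x *m blk G i j = 0].

Definition robust_objective (R : realType) (L n m T : nat) (Q : 'M[R]_n)
    (Rm : 'M[R]_m) (x : nat -> 'cV[R]_n) (u : nat -> 'cV[R]_m)
    (gam : R) (G : 'BM[R]_(L, (T - L).+1, n)) : R :=
  (1 - gam)^-1 *
  response_cost Q Rm (data_response x G) (data_response u G).

Definition robust_optimal (R : realType) (L n m T : nat) (Q : 'M[R]_n)
    (Rm : 'M[R]_m) (x : nat -> 'cV[R]_n) (u : nat -> 'cV[R]_m) (eps : R)
    (gam : R) (G : 'BM[R]_(L, (T - L).+1, n)) : Prop :=
  robust_feasible x eps gam G /\
  forall (gam' : R) (G' : 'BM[R]_(L, (T - L).+1, n)),
    robust_feasible x eps gam' G' ->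
    robust_objective Q Rm x u gam G <= robust_objective Q Rm x u gam' G'.

Definition synthesized (R : realType) (L n m T : nat)
    (x : nat -> 'cV[R]_n) (u : nat -> 'cV[R]_m)
    (G : 'BM[R]_(L, (T - L).+1, n)) : 'BM[R]_(L, m, n) :=
  data_response u G *m invmx (data_response x G).

(** * Random vectors *)

Definition coords (R : realType) (Omega : Type) (n : nat)
    (X : Omega -> 'cV[R]_n) (k : 'I_n) : Omega -> R := fun om => X om k ord0.

(* X ~ N(0, s^2 I_n): the law of X is the n-fold product of the one-dimensional
   law N(0, s^2), s being the standard deviation. *)
Definition isotropic_gaussian (d : measure_display) (Omega : measurableType d)
    (R : realType) (P : probability Omega R) (n : nat) (s : R)
    (X : Omega -> 'cV[R]_n) : Prop :=
  (forall k, measurable_fun setT (coords X k)) /\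
  forall S : 'I_n -> set R, (forall k, measurable (S k)) ->
    P [set om | forall k, S k (coords X k om)] =
    (\prod_(k < n) normal_prob 0 s (S k))%E.

(* [g_sigma_preimage (coords X)] is the sigma-algebra generated by X. *)
Definition mutually_independent (d : measure_display)
    (Omega : measurableType d) (R : realType) (P : probability Omega R)
    (I : finType) (n : nat) (X : I -> Omega -> 'cV[R]_n) : Prop :=
  forall (J : {set I}) (E : I -> set Omega),
    (forall i, i \in J -> g_sigma_preimage (coords (X i)) (E i)) ->
    P [set om | forall i, i \in J -> E i om] = (\prod_(i in J) P (E i))%E.

Definition average (R : realType) (Omega : Type) (N n : nat)
    (x : 'I_N -> Omega -> nat -> 'cV[R]_n) (om : Omega) (t : nat) : 'cV[R]_n :=
  N%:R^-1 *: \sum_(i < N) x i om t.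

(* sqrt (2 s^2 n T / N * log (2 n T / delta)) *)
Definition noise_level (R : realType) (n T N : nat) (s delta : R) : R :=
  Num.sqrt (2 * s ^+ 2 * n%:R * T%:R / N%:R * ln (2 * n%:R * T%:R / delta)).

(* Main.v *)
Require Import Defs.
From HB Require Import structures.
From mathcomp Require Import all_boot all_order all_algebra.
From mathcomp Require Import all_classical all_reals all_analysis.
From mathcomp Require Import measurable_realfun.
From mathcomp Require Import ring lra zify.

Set Implicit Arguments.
Unset Strict Implicit.
Unset Printing Implicit Defensive.

Import Order.TTheory GRing.Theory Num.Theory.
Import numFieldNormedType.Exports.
Local Open Scope classical_set_scope.
Local Open Scope ring_scope.

(** Averaging the trajectories gives [xbar = x + e], where [e] starts at [0] and
    is driven by the averaged noise [wbar].  A deterministic perturbation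
    argument is applied on an event of probability at least [1 - delta].

    Perturbation.  Responses built from the noisy data satisfy the achievability
    constraint with right-hand side [I + Delta], where [Delta] is [Z] applied to
    the data response of [wbar] ([data_response_achievable]).  The synthesized
    controller thus has the responses of the synthesis problem times
    [(I + Delta)^-1].  As [|Delta| <= sqrt L |H_L(wbar)| |G| <= gam], its true
    cost is at most the robust objective ([robust_cost_le]).  The optimal
    objective is bounded by that of an explicit feasible point: each block [G_k]
    of the optimal parameter is replaced by [G_k (I + H_1(e) G_k)^-1]
    ([candidate_feasible], [candidate_objective]).  With
    [rho = eps |T_W| |G*| <= 1/2] and [beta = sqrt L eps |G*| <= 1/3], this
    yields [Jhat <= (J* + q) / (1 - rho - beta)], where [q] bounds the cost of
    the state response to the error data
    [H_L(e) = O_L(A) H_1(e) + T_L H_L(wbar)]; the claimed inequality is then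
    elementary ([relative_gap]).

    Noise.  What is needed is [|H_L(wbar)| <= eps] and [|H_1(e)| <= |T_W| eps].
    Bounding the entries of [wbar] is too weak for the first, since a Hankel
    matrix repeats its entries.  Instead, the length-[T] Fourier transforms of
    the [n] coordinates of [wbar] are bounded by [eps / sqrt n].  A Hankel
    matrix with [T] antidiagonals is a submatrix of a [T]-periodic convolution,
    so this bounds its spectral norm ([hankel_form_le_cas]), and Parseval's
    identity bounds the energy of [wbar] ([energy_le_cas]), hence [H_1(e)].  In
    the real form of Hartley transforms there are [n T] Gaussian variables, all
    of variance [sigma^2 T / N]; the Chernoff bounds
    [2 exp (- ln (2 n T / delta))] add up to [delta] ([small_spectrum_event]).

    Existence of a minimiser.  The parameter [gam] ranges over a half-open
    interval.  When [Q^(1/2) <> 0] the cost is positive on the affine constraint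
    set, so the objective blows up at the open end and compactness applies
    ([robust_optimal_exists]).  When [Q^(1/2) = 0] the optimal cost is [0], and
    the explicit feasible point has objective [0]. *)

(** * Frobenius and spectral norms *)

Section Frobenius.
Context {R : realType}.

Lemma frobnorm_ge0 p q (M : 'M[R]_(p, q)) : 0 <= frobnorm M.
Proof. exact: sqrtr_ge0. Qed.

Lemma frobnorm_sqr p q (M : 'M[R]_(p, q)) :
  frobnorm M ^+ 2 = \sum_i \sum_j M i j ^+ 2.
Proof.
rewrite sqr_sqrtr //; apply: sumr_ge0 => i _.
by apply: sumr_ge0 => j _; exact: sqr_ge0.
Qed.

Lemma frobnorm_tr_sqr p q (M : 'M[R]_(p, q)) :
  frobnorm M ^+ 2 = \tr (M^T *m M).
Proof.
rewrite frobnorm_sqr exchange_big /=; apply: eq_bigr => j _.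
by rewrite mxE; apply: eq_bigr => i _; rewrite !mxE expr2.
Qed.

Lemma frobnorm_trmx p q (M : 'M[R]_(p, q)) : frobnorm M^T = frobnorm M.
Proof.
rewrite /frobnorm exchange_big /=; congr Num.sqrt.
by apply: eq_bigr => i _; apply: eq_bigr => j _; rewrite mxE.
Qed.

Lemma frobnorm0 p q : frobnorm (0 : 'M[R]_(p, q)) = 0.
Proof.
rewrite /frobnorm big1 ?sqrtr0 // => i _; rewrite big1 // => j _.
by rewrite mxE expr0n.
Qed.

Lemma frobnorm_eq0 p q (M : 'M[R]_(p, q)) : (frobnorm M == 0) = (M == 0).
Proof.
apply/eqP/eqP => [M0|->]; last exact: frobnorm0.
have : \sum_i \sum_j M i j ^+ 2 = 0 by rewrite -frobnorm_sqr M0 expr0n.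
move/eqP; rewrite psumr_eq0; last first.
  by move=> i _; apply: sumr_ge0 => j _; exact: sqr_ge0.
move=> /allP Mi; apply/matrixP => i j; rewrite mxE.
have /Mi : i \in index_enum 'I_p by rewrite mem_index_enum.
rewrite implyTb psumr_eq0; last by move=> k _; exact: sqr_ge0.
move=> /allP /(_ j); rewrite mem_index_enum => /(_ isT).
by rewrite implyTb sqrf_eq0 => /eqP.
Qed.

Lemma frobnormZ p q (a : R) (M : 'M[R]_(p, q)) :
  frobnorm (a *: M) = `|a| * frobnorm M.
Proof.
apply/eqP; rewrite -(@eqrXn2 _ 2) ?mulr_ge0 ?frobnorm_ge0 //.
rewrite exprMn real_normK ?num_real // !frobnorm_sqr mulr_sumr.
apply/eqP/eq_bigr => i _; rewrite mulr_sumr.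
by apply: eq_bigr => j _; rewrite mxE exprMn.
Qed.

Lemma frobnormN p q (M : 'M[R]_(p, q)) : frobnorm (- M) = frobnorm M.
Proof. by rewrite -scaleN1r frobnormZ normrN1 mul1r. Qed.

Lemma frobnormD_sqr p q (M N : 'M[R]_(p, q)) :
  frobnorm (M + N) ^+ 2 =
  frobnorm M ^+ 2 + \tr (M^T *m N) *+ 2 + frobnorm N ^+ 2.
Proof.
have tNM : \tr (N^T *m M) = \tr (M^T *m N).
  by rewrite -mxtrace_tr trmx_mul trmxK.
rewrite !frobnorm_tr_sqr [(M + N)^T]linearD mulmxDl !mulmxDr !mxtraceD tNM.
by rewrite mulr2n !addrA.
Qed.

(** Cauchy-Schwarz: expand the square of [|N| M - |M| N]. *)
Lemma mxtrace_le_frobnorm p q (M N : 'M[R]_(p, q)) :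
  \tr (M^T *m N) <= frobnorm M * frobnorm N.
Proof.
have [M0|M0] := eqVneq M 0.
  by rewrite M0 trmx0 mul0mx mxtrace0 frobnorm0 mul0r.
have Mp : 0 < frobnorm M.
  by rewrite lt_neqAle eq_sym frobnorm_eq0 M0 frobnorm_ge0.
have := sqr_ge0 (frobnorm (frobnorm N *: M + (- frobnorm M) *: N)).
rewrite frobnormD_sqr !frobnormZ normrN !ger0_norm ?frobnorm_ge0 //.
rewrite [(_ *: M)^T]linearZ /= -scalemxAl -scalemxAr !mxtraceZ.
set a := frobnorm M; set b := frobnorm N; set c := \tr _ => h.
have [N0|N0] := eqVneq N 0.
  by rewrite /c N0 mulmx0 mxtrace0 mulr_ge0 ?frobnorm_ge0.
have Np : 0 < b by rewrite lt_neqAle eq_sym frobnorm_eq0 N0 frobnorm_ge0.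
have ab : 0 < a * b *+ 2 by rewrite pmulrn_lgt0 ?mulr_gt0.
rewrite -(ler_pM2l ab); move: h; rewrite -subr_ge0 => h.
by rewrite -subr_ge0; apply: le_trans h _; rewrite le_eqVlt; apply/orP; left;
  apply/eqP; ring.
Qed.

Lemma ler_frobnormD p q (M N : 'M[R]_(p, q)) :
  frobnorm (M + N) <= frobnorm M + frobnorm N.
Proof.
rewrite -(@ler_pXn2r _ 2) ?nnegrE ?addr_ge0 ?frobnorm_ge0 //.
rewrite frobnormD_sqr sqrrD lerD2r lerD2l.
by rewrite lerMn2r mxtrace_le_frobnorm orbT.
Qed.

Lemma ler_frobnormB p q (M N : 'M[R]_(p, q)) :
  frobnorm M - frobnorm N <= frobnorm (M - N).
Proof. by rewrite lerBlDr -[X in frobnorm X <= _](subrK N) ler_frobnormD. Qed.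

Lemma ler_frobnorm_sum p q (I : finType) (F : I -> 'M[R]_(p, q)) :
  frobnorm (\sum_i F i) <= \sum_i frobnorm (F i).
Proof.
elim/big_ind2: _ => [|x a y b xa yb|//]; first by rewrite frobnorm0.
exact: le_trans (ler_frobnormD _ _) (lerD _ _).
Qed.

Lemma frobnorm_sum_col p q (M : 'M[R]_(p, q)) :
  frobnorm M ^+ 2 = \sum_j frobnorm (col j M) ^+ 2.
Proof.
rewrite frobnorm_sqr exchange_big; apply: eq_bigr => j _.
rewrite frobnorm_sqr; apply: eq_bigr => i _.
by rewrite big_ord1 mxE.
Qed.

Lemma frobnorm_sum_row p q (M : 'M[R]_(p, q)) :
  frobnorm M ^+ 2 = \sum_i frobnorm (row i M) ^+ 2.
Proof.
rewrite frobnorm_sqr; apply: eq_bigr => i _.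
by rewrite frobnorm_sqr big_ord1; apply: eq_bigr => j _; rewrite mxE.
Qed.

Lemma mxtrace_sqr_le_frobnorm p q (M N : 'M[R]_(p, q)) :
  (\tr (M^T *m N)) ^+ 2 <= frobnorm M ^+ 2 * frobnorm N ^+ 2.
Proof.
have h : `|\tr (M^T *m N)| <= frobnorm M * frobnorm N.
  rewrite ler_norml mxtrace_le_frobnorm andbT lerNl.
  by rewrite -(frobnormN N) -raddfN -mulmxN mxtrace_le_frobnorm.
by rewrite -exprMn -[leLHS]real_normK ?num_real // lerXn2r ?nnegrE
           ?mulr_ge0 ?frobnorm_ge0.
Qed.

Lemma frobnorm_mul p q r (M : 'M[R]_(p, q)) (N : 'M[R]_(q, r)) :
  frobnorm (M *m N) <= frobnorm M * frobnorm N.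
Proof.
rewrite -(@ler_pXn2r _ 2) ?nnegrE ?mulr_ge0 ?frobnorm_ge0 // exprMn.
rewrite frobnorm_sqr (frobnorm_sum_row M) mulr_suml; apply: ler_sum => i _.
rewrite (frobnorm_sum_col N) mulr_sumr; apply: ler_sum => j _.
have -> : (M *m N) i j = \tr ((row i M)^T^T *m col j N).
  by rewrite trmxK /mxtrace big_ord1 !mxE; apply: eq_bigr => k _; rewrite !mxE.
by rewrite -(frobnorm_trmx (row i M)) mxtrace_sqr_le_frobnorm.
Qed.

Lemma frobnorm_eq_sqr p q r s (M : 'M[R]_(p, q)) (N : 'M[R]_(r, s)) :
  frobnorm M ^+ 2 = frobnorm N ^+ 2 -> frobnorm M = frobnorm N.
Proof. by move/eqP; rewrite eqrXn2 ?frobnorm_ge0 // => /eqP. Qed.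

End Frobenius.

Section Spectral.
Context {R : realType}.

Lemma specnorm_has_sup p q (M : 'M[R]_(p, q)) :
  has_sup [set frobnorm (M *m v) | v in [set v : 'cV[R]_q | frobnorm v <= 1]].
Proof.
split.
  by exists (frobnorm (M *m (0 : 'cV_q))), 0 => //=; rewrite frobnorm0.
exists (frobnorm M) => _ [v /= v1 <-]; apply: le_trans (frobnorm_mul _ _) _.
by rewrite ler_piMr ?frobnorm_ge0.
Qed.

Lemma specnorm_ge0 p q (M : 'M[R]_(p, q)) : 0 <= specnorm M.
Proof.
apply: le_trans (frobnorm_ge0 (M *m (0 : 'cV_q))) _.
apply: sup_upper_bound; first exact: specnorm_has_sup.
by exists 0 => //=; rewrite frobnorm0.
Qed.

Lemma frobnorm_mul_specnorm_col p q (M : 'M[R]_(p, q)) (v : 'cV[R]_q) :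
  frobnorm (M *m v) <= specnorm M * frobnorm v.
Proof.
have [->|v0] := eqVneq v 0; first by rewrite mulmx0 !frobnorm0 mulr0.
have vp : 0 < frobnorm v.
  by rewrite lt_neqAle eq_sym frobnorm_eq0 v0 frobnorm_ge0.
rewrite -ler_pdivrMr // -[leLHS]mulrC -[X in X * _]ger0_norm ?invr_ge0
  ?frobnorm_ge0 //.
rewrite -frobnormZ scalemxAr.
apply: sup_upper_bound; first exact: specnorm_has_sup.
exists ((frobnorm v)^-1 *: v) => //=.
by rewrite frobnormZ ger0_norm ?invr_ge0 ?frobnorm_ge0 // mulVf ?gt_eqF.
Qed.

Lemma specnorm_le p q (M : 'M[R]_(p, q)) (c : R) : 0 <= c ->
  (forall v : 'cV[R]_q, frobnorm (M *m v) <= c * frobnorm v) -> specnorm M <= c.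
Proof.
move=> c0 h; apply: ge_sup; first by have [] := specnorm_has_sup M.
by move=> _ [v /= v1 <-]; apply: le_trans (h v) _; rewrite ler_piMr.
Qed.

Lemma specnorm_le_frobnorm p q (M : 'M[R]_(p, q)) : specnorm M <= frobnorm M.
Proof.
by apply: specnorm_le => [|v]; [exact: frobnorm_ge0 | exact: frobnorm_mul].
Qed.

Lemma specnorm_mul p q r (M : 'M[R]_(p, q)) (N : 'M[R]_(q, r)) :
  specnorm (M *m N) <= specnorm M * specnorm N.
Proof.
apply: specnorm_le => [|v]; first by rewrite mulr_ge0 ?specnorm_ge0.
rewrite -mulmxA; apply: le_trans (frobnorm_mul_specnorm_col _ _) _.
by rewrite -mulrA ler_wpM2l ?specnorm_ge0 // frobnorm_mul_specnorm_col.
Qed.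

Lemma specnormD p q (M N : 'M[R]_(p, q)) :
  specnorm (M + N) <= specnorm M + specnorm N.
Proof.
apply: specnorm_le => [|v]; first by rewrite addr_ge0 ?specnorm_ge0.
rewrite mulmxDl; apply: le_trans (ler_frobnormD _ _) _.
by rewrite mulrDl lerD ?frobnorm_mul_specnorm_col.
Qed.

(** [|M^T v|^2 = <v, M (M^T v)>] is at most [|v| |M| |M^T v|]. *)
Lemma specnorm_trmx p q (M : 'M[R]_(p, q)) : specnorm M^T = specnorm M.
Proof.
wlog suff: p q M / specnorm M^T <= specnorm M.
  by move=> h; apply/eqP; rewrite eq_le h -{1}(trmxK M) h.
apply: specnorm_le => [|v]; first exact: specnorm_ge0.
have [->|z0] := eqVneq (M^T *m v) 0.
  by rewrite frobnorm0 mulr_ge0 ?specnorm_ge0 ?frobnorm_ge0.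
have zp : 0 < frobnorm (M^T *m v).
  by rewrite lt_neqAle eq_sym frobnorm_eq0 z0 frobnorm_ge0.
rewrite -(ler_pM2r zp) -expr2 frobnorm_tr_sqr trmx_mul trmxK -mulmxA.
apply: le_trans (mxtrace_le_frobnorm _ _) _.
rewrite [leRHS]mulrAC [leRHS]mulrC ler_wpM2l ?frobnorm_ge0 //.
exact: frobnorm_mul_specnorm_col.
Qed.

Lemma frobnorm_mul_specnorml p q r (M : 'M[R]_(p, q)) (N : 'M[R]_(q, r)) :
  frobnorm (M *m N) <= specnorm M * frobnorm N.
Proof.
rewrite -(@ler_pXn2r _ 2) ?nnegrE ?mulr_ge0 ?specnorm_ge0 ?frobnorm_ge0 //.
rewrite exprMn !frobnorm_sum_col mulr_sumr; apply: ler_sum => j _.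
rewrite -exprMn lerXn2r ?nnegrE ?mulr_ge0 ?specnorm_ge0 ?frobnorm_ge0 //.
by rewrite !colE -mulmxA frobnorm_mul_specnorm_col.
Qed.

Lemma frobnorm_mul_specnormr p q r (M : 'M[R]_(p, q)) (N : 'M[R]_(q, r)) :
  frobnorm (M *m N) <= frobnorm M * specnorm N.
Proof.
by rewrite -frobnorm_trmx trmx_mul -(frobnorm_trmx M) -(specnorm_trmx N) mulrC
  frobnorm_mul_specnorml.
Qed.

Lemma unitmx_injective p (M : 'M[R]_p) :
  (forall v : 'cV[R]_p, M *m v = 0 -> v = 0) -> M \in unitmx.
Proof.
move=> h; rewrite -unitmx_tr -row_free_unit -kermx_eq0; apply/eqP/row_matrixP.
move=> i; rewrite row0; apply: trmx_inj; rewrite trmx0; apply: h.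
apply: trmx_inj; rewrite trmx_mul trmxK trmx0 -row_mul.
by rewrite mulmx_ker row0.
Qed.

Lemma unitmx_1D p (M : 'M[R]_p) : specnorm M < 1 -> 1%:M + M \in unitmx.
Proof.
move=> M1; apply: unitmx_injective => v /eqP.
rewrite mulmxDl mul1mx addr_eq0 => /eqP vE.
apply/eqP; rewrite -frobnorm_eq0; apply: contraTT M1 => v0; rewrite -leNgt.
have vp : 0 < frobnorm v by rewrite lt_neqAle eq_sym v0 frobnorm_ge0.
by rewrite -(ler_pM2r vp) mul1r {1}vE frobnormN frobnorm_mul_specnorm_col.
Qed.

(** If [v = (I + M) z] then [|v| >= |z| - |M z| >= (1 - r) |z|]. *)
Lemma specnorm_inv_1D p (M : 'M[R]_p) (r : R) : specnorm M <= r -> r < 1 ->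
  specnorm (invmx (1%:M + M)) <= (1 - r)^-1.
Proof.
move=> Mr r1; have U := unitmx_1D (le_lt_trans Mr r1).
have r1' : 0 < 1 - r by rewrite subr_gt0.
apply: specnorm_le => [|v]; first by rewrite invr_ge0 ltW.
set z := invmx _ *m v.
have -> : v = z + M *m z.
  by rewrite -[X in X + _]mul1mx -mulmxDl mulmxA mulmxV // mul1mx.
rewrite ler_pdivlMl // mulrBl mul1r.
have := ler_frobnormB z (- (M *m z)); rewrite opprK frobnormN.
apply: le_trans; rewrite lerD2l lerN2.
apply: le_trans (frobnorm_mul_specnorm_col _ _) _.
by rewrite ler_wpM2r ?frobnorm_ge0.
Qed.

End Spectral.

(** * Block matrices *)

Section BlockAlgebra.
Context {R : realType}.
Implicit Types (L p q r n m : nat).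

Lemma blkP L p q (M N : 'BM[R]_(L, p, q)) :
  (forall i j, blk M i j = blk N i j) -> M = N.
Proof. by move=> h; apply/(@mxblockP _ _ _ (fun=> p) (fun=> q)). Qed.

Lemma blk_blkmx L p q (F : 'I_L -> 'I_L -> 'M[R]_(p, q)) i j :
  blk (blkmx F) i j = F i j.
Proof. by rewrite /blk /blkmx (mxblockK (p_ := fun=> p) (q_ := fun=> q)). Qed.

Lemma blk_eta L p q (M : 'BM[R]_(L, p, q)) : blkmx (blk M) = M.
Proof. by apply: blkP => i j; rewrite blk_blkmx. Qed.

Lemma blkD L p q (M N : 'BM[R]_(L, p, q)) i j :
  blk (M + N) i j = blk M i j + blk N i j.
Proof. exact: (@submxblockD _ _ _ (fun=> p) (fun=> q)). Qed.

Lemma blkN L p q (M : 'BM[R]_(L, p, q)) i j : blk (- M) i j = - blk M i j.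
Proof. exact: (@submxblockN _ _ _ (fun=> p) (fun=> q)). Qed.

Lemma blk0 L p q i j : blk (0 : 'BM[R]_(L, p, q)) i j = 0.
Proof. exact: (@submxblock0 _ _ _ (fun=> p) (fun=> q)). Qed.

Lemma blk_mul L p q r (M : 'BM[R]_(L, p, q)) (N : 'BM[R]_(L, q, r)) i j :
  blk (M *m N) i j = \sum_k blk M i k *m blk N k j.
Proof.
by rewrite -{1}(blk_eta M) -{1}(blk_eta N) /blkmx
  (@mul_mxblock _ _ _ _ (fun=> p) (fun=> q) (fun=> r)) -/(blkmx _) blk_blkmx.
Qed.

Lemma tr_blk L p q (M : 'BM[R]_(L, p, q)) i j : blk M^T i j = (blk M j i)^T.
Proof. by apply/matrixP => a b; rewrite !mxE. Qed.

Lemma blkmx1 L p : blkmx (fun i j : 'I_L => if i == j then 1%:M else 0) =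
  1%:M :> 'BM[R]_(L, p, p).
Proof.
rewrite -(mxdiagZ (p_ := fun=> p)); apply: eq_mxblock => i j.
by case: eqP => // _; rewrite conform_mx_id.
Qed.

Lemma blk1 L p i j :
  blk (1%:M : 'BM[R]_(L, p, p)) i j = if i == j then 1%:M else 0.
Proof. by rewrite -blkmx1 blk_blkmx. Qed.

Lemma blk_blkdiag L p q (D : 'I_L -> 'M[R]_(p, q)) i j :
  blk (blkdiag D) i j = if i == j then D i else 0.
Proof. exact: blk_blkmx. Qed.

Lemma blkdiag_mul L p q r (D : 'I_L -> 'M[R]_(p, q))
    (E : 'I_L -> 'M[R]_(q, r)) :
  blkdiag D *m blkdiag E = blkdiag (fun i => D i *m E i).
Proof.
apply: blkP => i j; rewrite blk_mul blk_blkdiag (bigD1 i) //= big1 ?addr0.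
  by rewrite !blk_blkdiag eqxx; case: eqVneq; rewrite ?mulmx0.
by move=> k ki; rewrite blk_blkdiag eq_sym (negbTE ki) mul0mx.
Qed.

Lemma blk_Iotimesl L p q r (M : 'M[R]_(p, q)) (N : 'BM[R]_(L, q, r)) i j :
  blk (Iotimes L M *m N) i j = M *m blk N i j.
Proof.
rewrite blk_mul (bigD1 i) //= big1 ?addr0; first by rewrite blk_blkdiag eqxx.
by move=> k ki; rewrite blk_blkdiag eq_sym (negbTE ki) mul0mx.
Qed.

Lemma blk_downshiftl L p q (N : 'BM[R]_(L, p, q)) (i j : 'I_L) :
  blk (downshift R L p *m N) i j =
  \sum_(k < L | i == k.+1 :> nat) blk N k j.
Proof.
rewrite blk_mul [RHS]big_mkcond; apply: eq_bigr => k _.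
by rewrite blk_blkmx; case: ifP; rewrite ?mul1mx ?mul0mx.
Qed.

Lemma submxcol_blkmul L p q r (M : 'BM[R]_(L, p, q))
    (v : 'M[R]_(\sum_(i < L) q, r)) (i : 'I_L) :
  submxcol (p_ := fun=> p) (M *m v) i =
  \sum_k blk M i k *m submxcol (p_ := fun=> q) v k.
Proof.
rewrite -{1}(blk_eta M) -{1}(submxcolK (p_ := fun=> q) v) /blkmx.
by rewrite (mul_mxblock_mxrow (q_ := fun=> p) (p_ := fun=> q))
  (mxcolK (p_ := fun=> p)).
Qed.

Lemma frobnorm_mxcol_sqr L (p_ : 'I_L -> nat) q
    (C : forall i, 'M[R]_(p_ i, q)) :
  frobnorm (\mxcol_i C i) ^+ 2 = \sum_i frobnorm (C i) ^+ 2.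
Proof.
rewrite frobnorm_tr_sqr tr_mxcol mul_mxrow_mxcol raddf_sum.
by apply: eq_bigr => i _; rewrite frobnorm_tr_sqr.
Qed.

Lemma frobnorm_submxcol_sqr L (p_ : 'I_L -> nat) q
    (M : 'M[R]_(\sum_i p_ i, q)) :
  frobnorm M ^+ 2 = \sum_i frobnorm (submxcol M i) ^+ 2.
Proof. by rewrite -{1}(submxcolK M) frobnorm_mxcol_sqr. Qed.

Lemma frobnorm_blk_sqr L p q (M : 'BM[R]_(L, p, q)) :
  frobnorm M ^+ 2 = \sum_i \sum_j frobnorm (blk M i j) ^+ 2.
Proof.
rewrite (frobnorm_submxcol_sqr (p_ := fun=> p)); apply: eq_bigr => i _.
rewrite -frobnorm_trmx (frobnorm_submxcol_sqr (p_ := fun=> q)).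
apply: eq_bigr => j _; rewrite -frobnorm_trmx; congr (frobnorm _ ^+ 2).
by apply/matrixP => a b; rewrite !mxE.
Qed.

Lemma specnorm_blkdiag_le L p q (D : 'I_L -> 'M[R]_(p, q)) (c : R) : 0 <= c ->
  (forall i, specnorm (D i) <= c) -> specnorm (blkdiag D) <= c.
Proof.
move=> c0 Dc; apply: specnorm_le => // v.
rewrite -(@ler_pXn2r _ 2) ?nnegrE ?mulr_ge0 ?frobnorm_ge0 // exprMn.
rewrite (frobnorm_submxcol_sqr (p_ := fun=> p)).
rewrite (frobnorm_submxcol_sqr (p_ := fun=> q)) mulr_sumr;
  apply: ler_sum => i _.
rewrite submxcol_blkmul (bigD1 i) //= big1 ?addr0; last first.
  by move=> k ki; rewrite blk_blkdiag eq_sym (negbTE ki) mul0mx.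
rewrite blk_blkdiag eqxx -exprMn lerXn2r ?nnegrE ?mulr_ge0 ?frobnorm_ge0 //.
apply: le_trans (frobnorm_mul_specnorm_col _ _) _.
by rewrite ler_wpM2r ?frobnorm_ge0.
Qed.

Lemma specnorm_blkdiag_ge L p q (D : 'I_L -> 'M[R]_(p, q)) (i : 'I_L) :
  specnorm (D i) <= specnorm (blkdiag D).
Proof.
apply: specnorm_le => [|v]; first exact: specnorm_ge0.
pose e (w : nat) (z : 'cV[R]_w) : 'M[R]_(\sum_(k < L) w, 1) :=
  mxcol (p_ := fun=> w) (fun k : 'I_L => if k == i then z else 0).
have eN w (z : 'cV[R]_w) : frobnorm (e w z) = frobnorm z.
  apply: frobnorm_eq_sqr; rewrite (frobnorm_mxcol_sqr (p_ := fun=> w)).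
  rewrite (bigD1 i) //= eqxx big1 ?addr0 // => k /negbTE ->.
  by rewrite frobnorm0 expr0n.
rewrite -(eN _ v); apply: le_trans (frobnorm_mul_specnorm_col _ _).
rewrite -(eN _ (D i *m v)) le_eqVlt; apply/orP; left; apply/eqP; congr frobnorm.
apply/(@mxcolP _ _ (fun=> p)) => k.
rewrite submxcol_blkmul (bigD1 k) //= big1 ?addr0; last first.
  by move=> l lk; rewrite blk_blkdiag eq_sym (negbTE lk) mul0mx.
rewrite blk_blkdiag eqxx !(mxcolK (p_ := fun=> _)).
by case: eqVneq => [->//|]; rewrite mulmx0.
Qed.

Lemma specnorm_Iotimes L p q (M : 'M[R]_(p, q)) :
  specnorm (Iotimes L M) <= specnorm M.
Proof. by apply: specnorm_blkdiag_le; rewrite ?specnorm_ge0. Qed.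

Lemma frobnorm_Iotimes L p q (M : 'M[R]_(p, q)) :
  frobnorm (Iotimes L M) = Num.sqrt L%:R * frobnorm M.
Proof.
apply/eqP; rewrite -(@eqrXn2 _ 2) ?mulr_ge0 ?sqrtr_ge0 ?frobnorm_ge0 //.
rewrite exprMn frobnorm_blk_sqr sqr_sqrtr ?ler0n //.
rewrite (eq_bigr (fun=> frobnorm M ^+ 2)) => [|i _].
  by rewrite sumr_const card_ord mulr_natl.
rewrite (bigD1 i) //= blk_blkdiag eqxx big1 ?addr0 // => j ji.
by rewrite blk_blkdiag eq_sym (negbTE ji) frobnorm0 expr0n.
Qed.

Lemma specnorm_downshift L p : specnorm (downshift R L p) <= 1.
Proof.
apply: specnorm_le => [//|v]; rewrite mul1r.
rewrite -(@ler_pXn2r _ 2) ?nnegrE ?frobnorm_ge0 //.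
rewrite !(frobnorm_submxcol_sqr (p_ := fun=> p)).
have -> : \sum_(i < L) frobnorm (submxcol (p_ := fun=> p)
      (downshift R L p *m v) i) ^+ 2 =
    \sum_(i < L) \sum_(k < L | i == k.+1 :> nat)
      frobnorm (submxcol (p_ := fun=> p) v k) ^+ 2.
  apply: eq_bigr => i _; rewrite submxcol_blkmul.
  have [k /eqP ik|none] := pickP (fun k : 'I_L => i == k.+1 :> nat).
    have uniq_k (j : 'I_L) : (i == j.+1 :> nat) = (j == k).
      by rewrite ik eqSS -val_eqE eq_sym.
    rewrite (bigD1 k) //= big1 ?addr0 => [|j jk].
      rewrite (big_pred1 k) => [|j]; last exact: uniq_k.
      by rewrite blk_blkmx ik eqxx mul1mx.
    by rewrite blk_blkmx uniq_k (negbTE jk) mul0mx.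
  rewrite [RHS]big_pred0 // [X in frobnorm X]big1 ?frobnorm0 ?expr0n // => k _.
  by rewrite blk_blkmx none mul0mx.
rewrite (exchange_big_dep xpredT) //=; apply: ler_sum => k _.
have [kL|Lk] := ltnP k.+1 L.
  by rewrite (big_pred1 (Ordinal kL)) // => i; rewrite -val_eqE.
by rewrite big_pred0 ?sqr_ge0 // => i; apply/negbTE;
  rewrite neq_ltn (leq_trans (ltn_ord i)).
Qed.

Lemma blk_downshiftX L p k (i j : 'I_L) :
  blk (downshift R L p ^+ k) i j = if i == (k + j)%N :> nat then 1%:M else 0.
Proof.
elim: k i j => [|k IH] i j; first by rewrite expr0 blk1.
rewrite exprS blk_downshiftl; have [/eqP ij|ij] := ifPn.
  have kjL : (k + j < L)%N by rewrite (leq_trans _ (ltn_ord i)) // ij addSn.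
  rewrite (big_pred1 (Ordinal kjL)) => [|l]; first by rewrite IH eqxx.
  by rewrite ij addSn eqSS eq_sym.
rewrite big1 // => l /eqP il; rewrite IH; case: eqP => // lE.
by rewrite il lE addSn eqxx in ij.
Qed.

Lemma specnorm_downshiftX L p k : specnorm (downshift R L p ^+ k) <= 1.
Proof.
elim: k => [|k IH].
  by rewrite expr0; apply: specnorm_le => // v; rewrite mul1mx mul1r.
rewrite exprS; apply: le_trans (specnorm_mul _ _) _.
by rewrite mulr_ile1 ?specnorm_ge0 // specnorm_downshift.
Qed.

(** Each [Z ^ k] is a contraction, so the image of a stack of [L] blocks has
    norm at most the sum of their norms; Cauchy-Schwarz against the all-ones
    vector bounds this sum by [sqrt L] times the norm of the stack. *)
Lemma specnorm_downshifts L p : specnorm (downshifts R L p) <= Num.sqrt L%:R.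
Proof.
apply: specnorm_le => [|v]; first exact: sqrtr_ge0.
rewrite /downshifts -{1}(submxcolK (p_ := fun=> (\sum_(i < L) p)%N) v).
rewrite mul_mxrow_mxcol; apply: le_trans (ler_frobnorm_sum _) _.
set f := fun k => frobnorm (submxcol (p_ := fun=> (\sum_(i < L) p)%N) v k).
apply: (@le_trans _ _ (\sum_k f k)).
  apply: ler_sum => k _; apply: le_trans (frobnorm_mul_specnorm_col _ _) _.
  by rewrite ler_piMl ?frobnorm_ge0 // specnorm_downshiftX.
pose c := \col_(k < L) f k; pose o : 'cV[R]_L := const_mx 1.
have -> : \sum_k f k = \tr (o^T *m c).
  by rewrite /mxtrace big_ord1 mxE; apply: eq_bigr => k _; rewrite !mxE mul1r.
apply: le_trans (mxtrace_le_frobnorm _ _) _.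
have -> : frobnorm o = Num.sqrt L%:R.
  congr Num.sqrt; rewrite (eq_bigr (fun=> 1)) ?sumr_const ?card_ord // => i _.
  by rewrite big_ord1 mxE expr1n.
suff -> : frobnorm c = frobnorm v by [].
apply: frobnorm_eq_sqr; rewrite frobnorm_sqr.
rewrite (frobnorm_submxcol_sqr (p_ := fun=> (\sum_(i < L) p)%N)).
by apply: eq_bigr => k _; rewrite big_ord1 mxE.
Qed.

Lemma specnorm_data_response L p n T (s : nat -> 'cV[R]_p)
    (G : 'BM[R]_(L, (T - L).+1, n)) :
  specnorm (data_response s G) <=
  Num.sqrt L%:R * specnorm (hankel T L s) * specnorm G.
Proof.
apply: le_trans (specnorm_mul _ _) _; rewrite ler_wpM2r ?specnorm_ge0 //.
apply: le_trans (specnorm_mul _ _) _; rewrite ler_pM ?specnorm_ge0 //.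
  exact: specnorm_downshifts.
exact: specnorm_Iotimes.
Qed.

(** Applying [Z_L (I (x) H_L(s))] is a block convolution; this formula
    replaces reasoning about powers of the downshift. *)
Lemma blk_data_response L p n T (s : nat -> 'cV[R]_p)
    (G : 'BM[R]_(L, (T - L).+1, n)) i j :
  blk (data_response s G) i j =
  \sum_(k < L | (k <= i)%N) hankrow (T - L).+1 s (i - k) *m blk G k j.
Proof.
rewrite /data_response -mulmxA /downshifts.
set X := _ *m G; rewrite -{1}(submxcolK (p_ := fun=> (\sum_(i < L) p)%N) X).
rewrite mul_mxrow_mxcol.
have blk_sum (F : 'I_L -> 'BM[R]_(L, p, n)) :
    blk (\sum_k F k) i j = \sum_k blk (F k) i j.
  exact: (@submxblock_sum _ _ _ (fun=> p) (fun=> n)).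
rewrite blk_sum [RHS]big_mkcond; apply: eq_bigr => k _; rewrite blk_mul.
have XE l : blk (submxcol (p_ := fun=> (\sum_(i < L) p)%N) X k) l j =
    hankrow (T - L).+1 s l *m blk G k j.
  have -> : blk (submxcol (p_ := fun=> (\sum_(i < L) p)%N) X k) l j =
      submxcol (p_ := fun=> p) (blk (p := (\sum_(i < L) p)%N) X k j) l.
    by apply/matrixP => a b; rewrite !mxE.
  by rewrite blk_Iotimesl /hankel mxcol_mul (mxcolK (p_ := fun=> p)).
have [ki|ik] := leqP k i.
  have lL : (i - k < L)%N by rewrite (leq_ltn_trans (leq_subr _ _)).
  rewrite (bigD1 (Ordinal lL)) //= [X in _ + X]big1 ?addr0 => [|l].
    by rewrite blk_downshiftX /= subnKC // eqxx mul1mx XE.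
  rewrite -val_eqE /= => /eqP li; rewrite blk_downshiftX.
  by case: eqP => [iE|]; rewrite ?mul0mx //; case: li; rewrite iE addKn.
rewrite big1 // => l _; rewrite blk_downshiftX; case: eqP => [iE|];
  rewrite ?mul0mx //.
by move: ik; rewrite iE ltnNge leq_addr.
Qed.

End BlockAlgebra.

(** * Data responses and closed loops *)

Section Responses.
Context {R : realType}.
Implicit Types (L p q r n m T : nat).

Lemma blk_lower_unitmx L n (M : 'BM[R]_(L, n, n)) :
  blk_lower M -> (forall i, blk M i i = 1%:M) -> M \in unitmx.
Proof.
move=> Ml Md; rewrite unitmxE -(blk_eta M) det_trig; last first.
  apply/(@is_trig_mxblockP _ _ (fun=> n)); split=> [|i]; first exact: Ml.
  rewrite -/(blk M i i) Md; apply/is_trig_mxP => a b ab; rewrite mxE.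
  by rewrite -val_eqE ltn_eqF.
by rewrite big1 ?unitr1 // => k _; rewrite mxE Md mxE eqxx.
Qed.

(** The constraints of the robust synthesis problem that are affine in [G];
    the norm bound is left out. *)
Definition admissible L n T (s : nat -> 'cV[R]_n)
    (G : 'BM[R]_(L, (T - L).+1, n)) :=
  [/\ blk_lower G, forall i : 'I_L, in_Gamma s (blk G i i) &
      forall i j : 'I_L, i != j -> hankel1 T L s *m blk G i j = 0].

Lemma admissible_blkdiag L n T (s : nat -> 'cV[R]_n)
    (G : 'I_L -> 'M[R]_((T - L).+1, n)) :
  (forall k, in_Gamma s (G k)) -> admissible s (blkdiag G).
Proof.
move=> GG; split=> [i j ij|i|i j /negbTE ij]; rewrite blk_blkdiag.
- by rewrite -val_eqE ltn_eqF.
- by rewrite eqxx.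
- by rewrite ij mulmx0.
Qed.

(** The response is block lower triangular with diagonal blocks
    [H_1(s) G(i, i) = I]. *)
Lemma data_response_unitmx L n T (s : nat -> 'cV[R]_n)
    (G : 'BM[R]_(L, (T - L).+1, n)) :
  admissible s G -> data_response s G \in unitmx.
Proof.
case=> Gl Gd _; apply: blk_lower_unitmx => [i j ij|i];
  rewrite blk_data_response.
  by rewrite big1 // => k ki; rewrite Gl ?mulmx0 // (leq_ltn_trans ki ij).
rewrite (bigD1 i) //= big1 ?addr0 => [|k /andP[ki kni]].
  by rewrite subnn; exact: Gd.
by rewrite Gl ?mulmx0 // ltn_neqAle ki andbT.
Qed.

Lemma hankrow_rec n m W (A : 'M[R]_n) (B : 'M[R]_(n, m))
    (s w : nat -> 'cV[R]_n) (u : nat -> 'cV[R]_m) k :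
  (forall t, s t.+1 = A *m s t + B *m u t + w t) ->
  hankrow W s k.+1 =
  A *m hankrow W s k + B *m hankrow W u k + hankrow W w k.
Proof.
move=> sE; apply/matrixP => a t; rewrite mxE addnS sE !mxE.
by congr (_ + _ + _); apply: eq_bigr => b _; rewrite !mxE.
Qed.

(** Row [k + 1] of a Hankel matrix is given by row [k] through the dynamics, so
    the constraint telescopes: what survives is the first block row, which the
    constraints on [G] turn into [I], and the contribution of the noise. *)
Lemma data_response_achievable L n m T (A : 'M[R]_n) (B : 'M[R]_(n, m))
    (s w : nat -> 'cV[R]_n) (u : nat -> 'cV[R]_m)
    (G : 'BM[R]_(L, (T - L).+1, n)) :
  (forall t, s t.+1 = A *m s t + B *m u t + w t) -> admissible s G ->
  (1%:M - downshift R L n *m Iotimes L A) *m data_response s G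
  - (downshift R L n *m Iotimes L B) *m data_response u G =
  1%:M + downshift R L n *m data_response w G.
Proof.
move=> sE [Gl Gd Go]; rewrite mulmxBl mul1mx -!mulmxA -addrA -opprD -mulmxDr.
apply/eqP; rewrite subr_eq -addrA -mulmxDr; apply/eqP.
set Y := _ + (_ + _); apply: blkP => i j; rewrite blkD blk1 blk_downshiftl.
rewrite blk_data_response (bigD1 i) //= subnn addrC [RHS]addrC; congr (_ + _);
  last first.
  by case: eqVneq => [<-|ij]; [exact: Gd | exact: Go].
have YE k : blk Y k j = \sum_(l < L | (l <= k)%N)
    hankrow (T - L).+1 s (k - l).+1 *m blk G l j.
  rewrite /Y !blkD !blk_Iotimesl !blk_data_response !mulmx_sumr -!big_split /=.
  apply: eq_bigr => l lk; rewrite (hankrow_rec _ _ sE) !mulmxDl !mulmxA.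
  by rewrite addrC.
have [k /eqP ik|none] := pickP (fun k : 'I_L => i == k.+1 :> nat).
  have uniq_k (l : 'I_L) : (i == l.+1 :> nat) = (l == k).
    by rewrite ik eqSS -val_eqE eq_sym.
  rewrite [RHS](big_pred1 k) => [|l]; last exact: uniq_k.
  rewrite YE; apply: eq_big => l.
    by rewrite -val_eqE /= andbC -ltn_neqAle ik ltnS.
  by move=> /andP[li nli]; rewrite ik subSn // -ltnS -ik ltn_neqAle li andbT.
rewrite [RHS]big_pred0 // big1 // => l /andP[li lni].
have ltli : (l < i)%N by rewrite ltn_neqAle li andbT.
have iL : (i.-1 < L)%N by rewrite (leq_ltn_trans (leq_pred _)).
have := none (Ordinal iL); rewrite /= prednK ?eqxx //;
  exact: leq_ltn_trans ltli.
Qed.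

(** Multiplying [I - Z (A + B Phiu Phix^-1)] by [Phix] gives [D]. *)
Lemma closed_loopE L n m (A : 'M[R]_n) (B : 'M[R]_(n, m))
    (Phix : 'BM[R]_(L, n, n)) (Phiu : 'BM[R]_(L, m, n)) (D : 'BM[R]_(L, n, n)) :
  Phix \in unitmx -> D \in unitmx ->
  (1%:M - downshift R L n *m Iotimes L A) *m Phix
  - (downshift R L n *m Iotimes L B) *m Phiu = D ->
  closed_loop A B (Phiu *m invmx Phix) = Phix *m invmx D.
Proof.
move=> Ux UD E; rewrite /closed_loop; set M := _ - _.
have MD : M *m (Phix *m invmx D) = 1%:M.
  rewrite mulmxA -(mulmxV UD); congr (_ *m _);
    rewrite -E /M mulmxDr opprD addrA.
  by rewrite mulmxBl !mulmxA mulmxKV.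
have [MU _] := mulmx1_unit MD.
by rewrite -[LHS]mulmx1 -MD mulKmx.
Qed.

Lemma LQG_cost_response L n m (A : 'M[R]_n) (B : 'M[R]_(n, m)) (Q : 'M[R]_n)
    (Rm : 'M[R]_m)
    (Phix : 'BM[R]_(L, n, n)) (Phiu : 'BM[R]_(L, m, n))
    (D : 'BM[R]_(L, n, n)) :
  Phix \in unitmx -> D \in unitmx ->
  (1%:M - downshift R L n *m Iotimes L A) *m Phix
  - (downshift R L n *m Iotimes L B) *m Phiu = D ->
  LQG_cost A B Q Rm (Phiu *m invmx Phix) =
  response_cost Q Rm (Phix *m invmx D) (Phiu *m invmx D).
Proof.
move=> Ux UD E; rewrite /LQG_cost (closed_loopE Ux UD E).
by rewrite mulmxA mulmxKV.
Qed.

Lemma response_cost_mul L n m (Q : 'M[R]_n) (Rm : 'M[R]_m)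
    (Phix : 'BM[R]_(L, n, n)) (Phiu : 'BM[R]_(L, m, n)) (D : 'BM[R]_(L, n, n)) :
  response_cost Q Rm (Phix *m D) (Phiu *m D) <=
  response_cost Q Rm Phix Phiu * specnorm D.
Proof. by rewrite /response_cost -mul_col_mx mulmxA frobnorm_mul_specnormr. Qed.

Lemma response_cost_ge0 L n m (Q : 'M[R]_n) (Rm : 'M[R]_m)
    (Phix : 'BM[R]_(L, n, n)) (Phiu : 'BM[R]_(L, m, n)) :
  0 <= response_cost Q Rm Phix Phiu.
Proof. exact: frobnorm_ge0. Qed.

Lemma response_costD L n m (Q : 'M[R]_n) (Rm : 'M[R]_m)
    (Phix E : 'BM[R]_(L, n, n)) (Phiu : 'BM[R]_(L, m, n)) :
  response_cost Q Rm (Phix + E) Phiu <=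
  response_cost Q Rm Phix Phiu + frobnorm (psdsqrt (Iotimes L Q) *m E).
Proof.
have colE : col_mx (Phix + E) Phiu = col_mx Phix Phiu + col_mx E 0.
  by rewrite add_col_mx addr0.
rewrite /response_cost colE mulmxDr; apply: le_trans (ler_frobnormD _ _) _.
rewrite lerD2l mul_block_col !mulmx0 !mul0mx !addr0.
rewrite -(@ler_pXn2r _ 2) ?nnegrE ?frobnorm_ge0 //.
by rewrite frobnorm_tr_sqr tr_col_mx mul_row_col mxtraceD
  -!frobnorm_tr_sqr frobnorm0 expr0n addr0.
Qed.

Lemma response_cost_sqr L n m (Q : 'M[R]_n) (Rm : 'M[R]_m)
    (Phix : 'BM[R]_(L, n, n)) (Phiu : 'BM[R]_(L, m, n)) :
  response_cost Q Rm Phix Phiu ^+ 2 =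
  frobnorm (psdsqrt (Iotimes L Q) *m Phix) ^+ 2 +
  frobnorm (psdsqrt (Iotimes L Rm) *m Phiu) ^+ 2.
Proof.
rewrite /response_cost mul_block_col !mul0mx addr0 add0r.
by rewrite frobnorm_tr_sqr tr_col_mx mul_row_col mxtraceD -!frobnorm_tr_sqr.
Qed.

End Responses.

(** * Positive semidefinite square roots *)

Section SquareRoot.
Context {R : realType}.

(** Along [v + t S v] the form is [2 t |S v|^2 + t^2 c], which is negative for
    some [t < 0] unless [S v = 0]. *)
Lemma psdmx_form_eq0 p (S : 'M[R]_p) (v : 'cV[R]_p) :
  psdmx S -> (v^T *m S *m v) ord0 ord0 = 0 -> S *m v = 0.
Proof.
move=> [Ss Sp] v0; apply/eqP; rewrite -frobnorm_eq0.
have tr00 (M : 'M[R]_1) : M ord0 ord0 = \tr M by rewrite /mxtrace big_ord1.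
pose z := S *m v; pose c := (z^T *m S *m z) ord0 ord0.
have fE t : ((v + t *: z)^T *m S *m (v + t *: z)) ord0 ord0 =
    (t * frobnorm z ^+ 2) *+ 2 + t ^+ 2 * c.
  have zSv : \tr (z^T *m S *m v) = frobnorm z ^+ 2.
    by rewrite frobnorm_tr_sqr -mulmxA.
  have vSz : \tr (v^T *m S *m z) = frobnorm z ^+ 2.
    by rewrite frobnorm_tr_sqr /z trmx_mul Ss.
  have -> : (v + t *: z)^T = v^T + t *: z^T.
    by apply/matrixP => i j; rewrite !mxE.
  rewrite tr00 !mulmxDl !mulmxDr !mxtraceD.
  rewrite -!scalemxAl -!scalemxAr !mxtraceZ zSv vSz -!tr00 v0 -/c.
  by ring.
have c0 : 0 <= c by exact: Sp.
rewrite -/z -(@eqrXn2 _ 2) ?frobnorm_ge0 // expr0n /= eq_le sqr_ge0 andbT.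
set a := frobnorm z ^+ 2; rewrite leNgt; apply/negP => a0.
(* a small negative step makes the linear term dominate *)
have := Sp (v + (- (a / (c + 1))) *: z); rewrite fE -/a.
have c1 : 0 < c + 1 by rewrite ltr_wpDl.
rewrite leNgt => /negP; apply.
have -> : - (a / (c + 1)) * a *+ 2 + (- (a / (c + 1))) ^+ 2 * c =
    - ((a / (c + 1)) ^+ 2 * (c + 2)) by field; rewrite gt_eqF.
by rewrite oppr_lt0 mulr_gt0 ?exprn_gt0 ?divr_gt0 // ltr_wpDl.
Qed.

Lemma psdmx_diag_form p q (S : 'M[R]_p) (D : 'M[R]_(p, q)) j :
  (D^T *m S *m D) j j = ((col j D)^T *m S *m col j D) ord0 ord0.
Proof.
by rewrite tr_col -row_mul [LHS]mxE [RHS]mxE; apply: eq_bigr => k _;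
  rewrite !mxE.
Qed.

Lemma psdmx_trace_ge0 p q (S : 'M[R]_p) (D : 'M[R]_(p, q)) :
  psdmx S -> 0 <= \tr (D^T *m S *m D).
Proof. by move=> [_ Sp]; apply: sumr_ge0 => j _; rewrite psdmx_diag_form. Qed.

Lemma psdmx_trace_eq0 p q (S : 'M[R]_p) (D : 'M[R]_(p, q)) :
  psdmx S -> \tr (D^T *m S *m D) = 0 -> S *m D = 0.
Proof.
move=> pS tr0; have [_ Sp] := pS.
apply/matrixP => i j; have := tr0; rewrite /mxtrace => /eqP.
rewrite psumr_eq0 => [|k _]; last by rewrite psdmx_diag_form.
move=> /allP/(_ j); rewrite mem_index_enum => /(_ isT) /eqP.
rewrite psdmx_diag_form => /(psdmx_form_eq0 pS) /matrixP /(_ i ord0).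
by rewrite colE mulmxA -colE !mxE.
Qed.

(** If [S1] and [S2] are roots of the same matrix, then [D = S1 - S2] satisfies
    [D (S1 + S2) + (S1 + S2) D = 0]; multiplying by [D] and taking traces, both
    [D S1 D] and [D S2 D] have trace [0], so [S1 D = S2 D = 0] and
    [D ^ 2 = 0]. *)
Lemma psdmx_root_unique p (S1 S2 : 'M[R]_p) :
  psdmx S1 -> psdmx S2 -> S1 *m S1 = S2 *m S2 -> S1 = S2.
Proof.
move=> p1 p2 S12; pose D : 'M[R]_p := S1 - S2.
have Ds : D^T = D.
  by have [[s1 _] [s2 _]] := (p1, p2); rewrite /D [LHS]linearB /= s1 s2.
have E : D *m (S1 + S2) + (S1 + S2) *m D = 0.
  rewrite /D !mulmxBl !mulmxBr !mulmxDr !mulmxDl S12.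
  by apply/matrixP => i j; rewrite !mxE; ring.
have tE : \tr (D^T *m S1 *m D) + \tr (D^T *m S2 *m D) = 0.
  have : \tr (D *m (D *m (S1 + S2) + (S1 + S2) *m D)) = 0.
    by rewrite E mulmx0 mxtrace0.
  have trC : \tr (D *m (D *m (S1 + S2))) = \tr (D *m ((S1 + S2) *m D)).
    by rewrite mxtrace_mulC mulmxA.
  have trS : \tr (D *m ((S1 + S2) *m D)) =
    \tr (D *m S1 *m D) + \tr (D *m S2 *m D).
    by rewrite -mxtraceD -!mulmxA -mulmxDr -mulmxDl.
  by rewrite mulmxDr mxtraceD trC trS Ds; lra.
have t1 := psdmx_trace_ge0 D p1; have t2 := psdmx_trace_ge0 D p2.
have [/(psdmx_trace_eq0 p1) z1 /(psdmx_trace_eq0 p2) z2] :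
    \tr (D^T *m S1 *m D) = 0 /\ \tr (D^T *m S2 *m D) = 0 by split; lra.
apply/eqP; rewrite -subr_eq0 -/D -frobnorm_eq0 -(@eqrXn2 _ 2) ?frobnorm_ge0 //.
by rewrite expr0n /= frobnorm_tr_sqr Ds {1}/D mulmxBl z1 z2 subrr mxtrace0.
Qed.

Lemma psdsqrtE p (S M : 'M[R]_p) : psdmx S -> S *m S = M -> psdsqrt M = S.
Proof.
move=> pS SM; have [pX XM] := xgetPex 0
  (ex_intro [set S : 'M[R]_p | psdmx S /\ S *m S = M] S (conj pS SM)).
by apply: psdmx_root_unique; rewrite ?XM ?SM.
Qed.

Lemma psdmx_Iotimes L p (S : 'M[R]_p) : psdmx S -> psdmx (Iotimes L S).
Proof.
move=> pS; have [Ss Sp] := pS; split.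
  apply: blkP => i j; rewrite tr_blk !blk_blkdiag eq_sym.
  by case: eqP; rewrite ?trmx0.
move=> v; rewrite -[X in _ *m X](submxcolK (p_ := fun=> p)).
rewrite -{1}(submxcolK (p_ := fun=> p) v) tr_mxcol.
rewrite (mul_mxrow_mxblock (p_ := fun=> p) (q_ := fun=> p)).
rewrite mul_mxrow_mxcol summxE.
apply: sumr_ge0 => i _; rewrite (bigD1 i) //= eqxx big1 ?addr0 => [|k ki].
  exact: Sp.
by rewrite (negbTE ki) mulmx0.
Qed.

(** If [Q] has a root, this is uniqueness of the root of [I (x) Q].  Otherwise
    both sides are the default [0], because a root of [I (x) Q] would contain
    one of [Q]: conjugating by the block sign matrix that flips block [k]
    preserves the root, so by uniqueness its off-diagonal blocks vanish. *)
Lemma psdsqrt_Iotimes L p (Q : 'M[R]_p) : (0 < L)%N ->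
  psdsqrt (Iotimes L Q) = Iotimes L (psdsqrt Q).
Proof.
move=> L0; have [[S [pS SQ]]|noroot] :=
  pselect (exists S : 'M[R]_p, psdmx S /\ S *m S = Q).
  rewrite (psdsqrtE pS SQ); apply: psdsqrtE; first exact: psdmx_Iotimes.
  by rewrite /Iotimes blkdiag_mul SQ.
have -> : psdsqrt Q = 0.
  by apply: xgetPN => S h; apply: noroot; exists S.
rewrite /psdsqrt xgetPN; last first.
  move=> S [pS SQ]; apply: noroot; have [Ss Sp] := pS.
  have off (k j : 'I_L) : j != k -> blk S k j = 0.
    move=> jk; pose F : 'BM[R]_(L, p, p) :=
      blkdiag (fun i : 'I_L => if i == k then - 1%:M else 1%:M).
    have Fs : F^T = F.
      apply: blkP => a b; rewrite tr_blk !blk_blkdiag eq_sym.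
      case: eqP => [->|]; rewrite ?trmx0 //.
      by case: ifP => _; rewrite ?trmx1 // [LHS]linearN /= trmx1.
    have FF : F *m F = 1%:M.
      rewrite blkdiag_mul -blkmx1; congr blkmx; apply/funext => a;
        apply/funext => b.
      by do 2!case: ifP => // _; rewrite ?mulmxN ?mulNmx mulmx1 ?opprK.
    have pF : psdmx (F *m S *m F).
      split; first by rewrite !trmx_mul Fs Ss mulmxA.
      by move=> v; have := Sp (F *m v); rewrite trmx_mul Fs !mulmxA.
    have FSF : F *m S *m F = S.
      apply: psdmx_root_unique => //.
      rewrite -mulmxA [F *m (_ *m _)]mulmxA [F *m (_ *m _)]mulmxA FF mul1mx.
      rewrite mulmxA -[F *m S *m S]mulmxA SQ -[X in _ = X]mulmx1 -FF mulmxA.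
      congr (_ *m F); apply: blkP => a b; rewrite blk_mul blk_Iotimesl.
      rewrite (bigD1 a) //= [X in _ + X]big1 ?addr0 => [|c ca]; last first.
        by rewrite blk_blkdiag eq_sym (negbTE ca) mul0mx.
      rewrite !blk_blkdiag eqxx; case: (a =P b) => [->|]; rewrite ?mulmx0 //.
      by case: ifP => _; rewrite ?mulmxN ?mulNmx mulmx1 mul1mx.
    have := congr1 (fun M => blk M k j) FSF; rewrite !blk_mul.
    rewrite (bigD1 j) //= [X in _ + X]big1 ?addr0 => [|c cj]; last first.
      by rewrite blk_blkdiag (negbTE cj) mulmx0.
    rewrite blk_mul (bigD1 k) //= [X in _ + X]big1 ?addr0 => [|c ck];
      last first.
      by rewrite blk_blkdiag eq_sym (negbTE ck) mul0mx.
    rewrite !blk_blkdiag !eqxx (negbTE jk) mulmx1 mulNmx mul1mx => h.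
    by apply/matrixP => a b; have /matrixP/(_ a b) := h; rewrite !mxE; lra.
  pose i0 := Ordinal L0; exists (blk S i0 i0); split; first split.
  - by rewrite -tr_blk Ss.
  - move=> v; pose V : 'M[R]_(\sum_(i < L) p, 1) :=
      mxcol (p_ := fun=> p) (fun k : 'I_L => if k == i0 then v else 0).
    have := Sp V; rewrite -mulmxA -[X in _ *m X](submxcolK (p_ := fun=> p)).
    rewrite tr_mxcol mul_mxrow_mxcol (bigD1 i0) //= [X in _ + X]big1 ?addr0.
      rewrite submxcol_blkmul (bigD1 i0) //= [X in _ + X]big1 ?addr0.
        by rewrite (mxcolK (p_ := fun=> p)) eqxx mulmxA.
      by move=> k /negbTE k0; rewrite (mxcolK (p_ := fun=> p)) k0 mulmx0.
    by move=> k /negbTE k0; rewrite k0 trmx0 mul0mx.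
  - have := congr1 (fun M => blk M i0 i0) SQ; rewrite blk_mul blk_blkdiag eqxx.
    rewrite (bigD1 i0) //= [X in _ + X]big1 ?addr0 // => k ki.
    by rewrite off // mul0mx.
apply: blkP => i j; rewrite blk0 blk_blkdiag; by case: ifP.
Qed.

End SquareRoot.

(** * Discrete Fourier and Hartley transforms *)

Section DiscreteFourier.
Context {R : realType}.

Definition dft_angle (T k : nat) : R := k%:R * (pi *+ 2 / T%:R).

Lemma dft_angleD T k l : dft_angle T (k + l) = dft_angle T k + dft_angle T l.
Proof. by rewrite /dft_angle natrD mulrDl. Qed.

Lemma dft_angle_period T j : (0 < T)%N -> dft_angle T (j * T) = (pi *+ 2) *+ j.
Proof.
move=> T0; have T1 : T%:R != 0 :> R by rewrite pnatr_eq0 -lt0n.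
by rewrite /dft_angle natrM -[RHS]mulr_natl -mulrA [T%:R * _]mulrC divfK.
Qed.

(** Multiplying by [2 sin (pi r / T)] makes the sum telescope. *)
Lemma sum_cos_dft T r : (0 < r < T)%N ->
  \sum_(j < T) cos (dft_angle T (j * r)) = 0.
Proof.
move=> /andP[r0 rT]; have T0 : (0 < T)%N by exact: leq_trans rT.
pose h : R := r%:R * (pi / T%:R).
have h_gt0 : 0 < sin h.
  apply: sin_gt0_pi; rewrite /h mulr_gt0 ?ltr0n ?divr_gt0 ?pi_gt0 ?ltr0n //=.
  by rewrite mulrCA -ltr_pdivlMl ?pi_gt0 // mulVf ?gt_eqF ?pi_gt0 //
     ltr_pdivrMr ?ltr0n // mul1r ltr_nat.
pose f (j : nat) : R := sin (dft_angle T (j * r) - h).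
have fE (j : nat) : f j.+1 - f j = sin h * 2 * cos (dft_angle T (j * r)).
  have hh : dft_angle T r = h *+ 2 by rewrite /dft_angle /h; ring.
  rewrite /f mulSn dft_angleD hh; set y := dft_angle T (j * r).
  have -> : h *+ 2 + y - h = h + y by ring.
  by rewrite sinB sinD; ring.
have : sin h * 2 * \sum_(j < T) cos (dft_angle T (j * r)) = 0.
  rewrite mulr_sumr (eq_bigr (fun j : 'I_T => f j.+1 - f j)) => [|j _].
    rewrite -(big_mkord xpredT (fun j => f j.+1 - f j)) telescope_sumr //.
    rewrite /f mulnC dft_angle_period // mul0n [_ *+ r - h]addrC.
    by rewrite (periodicn (@sinD2pi R)) /dft_angle mul0r add0r subrr.
  by rewrite fE.
move/eqP; rewrite mulf_eq0 mulf_eq0 pnatr_eq0 /= orbF gt_eqF //= => /eqP.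
exact.
Qed.

Lemma dft_orthogonal T s t : (s < T)%N -> (t < T)%N ->
  \sum_(j < T) cos (dft_angle T (j * s) - dft_angle T (j * t)) =
  (if s == t then T%:R else 0).
Proof.
wlog st : s t / (t <= s)%N => [h sT tT|sT tT].
  have [/h -> //|/ltnW ts] := leqP t s.
  rewrite eq_sym -h //; apply: eq_bigr => j _.
  by rewrite -cosN opprB.
have E (j : 'I_T) : cos (dft_angle T (j * s) - dft_angle T (j * t)) =
    cos (dft_angle T (j * (s - t))).
  by congr cos; rewrite -{1}(subnKC st) mulnDr dft_angleD addrAC subrr add0r.
rewrite (eq_bigr _ (fun j _ => E j)).
have [->|nst] := eqVneq s t.
  under eq_bigr do rewrite subnn muln0 /dft_angle mul0r cos0.
  by rewrite sumr_const card_ord.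
by rewrite sum_cos_dft // subn_gt0 ltn_neqAle eq_sym nst st
  (leq_ltn_trans (leq_subr _ _)).
Qed.

(** Reflection [t -> T - t] changes the sign of every term. *)
Lemma sum_sin_dft T k : (0 < T)%N -> \sum_(t < T) sin (dft_angle T (k * t)) = 0.
Proof.
move=> T0; pose f t : R := sin (dft_angle T (k * t)).
have f0 : f 0%N = 0 by rewrite /f muln0 /dft_angle mul0r sin0.
have fT : f T = 0.
  by rewrite /f dft_angle_period // -[_ *+ k]add0r
    (periodicn (@sinD2pi R)) sin0.
have shift : \sum_(t < T) f t.+1 = \sum_(t < T) f t.
  have : \sum_(t < T.+1) f t = \sum_(t < T) f t
    by rewrite big_ord_recr /= fT addr0.
  by rewrite big_ord_recl f0 add0r.
have refl : \sum_(t < T) f t.+1 = - \sum_(t < T) f t.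
  rewrite (reindex_inj rev_ord_inj) -sumrN; apply: eq_bigr => t _ /=.
  rewrite subnSK // /f mulnBr -sinN -(periodicn (@sinD2pi R) k (- _)).
  congr sin; rewrite -(@dft_angle_period T) //.
  have kt : (k * t <= k * T)%N by rewrite leq_mul2l ltnW ?orbT.
  by rewrite -[in RHS](subnKC kt) dft_angleD addKr.
by move: refl; rewrite shift /f => h; lra.
Qed.

(** The Hartley kernel.  It serves as a real Fourier kernel because at every
    frequency its squares sum to [T] ([sum_cas_sqr]): the transform of white
    noise has the same variance at all frequencies. *)
Definition cas (T k : nat) : R := cos (dft_angle T k) + sin (dft_angle T k).

Lemma sum_cas_sqr T j : (0 < T)%N -> \sum_(t < T) cas T (j * t) ^+ 2 = T%:R.
Proof.
move=> T0.
have E (t : 'I_T) : cas T (j * t) ^+ 2 = 1 + sin (dft_angle T (j * 2 * t)).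
  rewrite mulnAC muln2 -addnn dft_angleD -mulr2n sin_mulr2n /cas.
  set x := dft_angle _ _; rewrite -(cos2Dsin2 x); ring.
rewrite (eq_bigr _ (fun t _ => E t)) big_split /= sum_sin_dft // addr0.
by rewrite sumr_const card_ord.
Qed.

Definition dft_cos T q (x : 'I_q -> R) (j : nat) : R :=
  \sum_t x t * cos (dft_angle T (j * t)).
Definition dft_sin T q (x : 'I_q -> R) (j : nat) : R :=
  \sum_t x t * sin (dft_angle T (j * t)).

Lemma dft_parseval T q (x : 'I_q -> R) : (q <= T)%N ->
  \sum_(j < T) (dft_cos T x j ^+ 2 + dft_sin T x j ^+ 2) =
  T%:R * \sum_t x t ^+ 2.
Proof.
move=> qT.
have E (j : 'I_T) : dft_cos T x j ^+ 2 + dft_sin T x j ^+ 2 = \sum_s \sum_t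
    x s * x t * cos (dft_angle T (j * s) - dft_angle T (j * t)).
  rewrite !expr2 /dft_cos /dft_sin !mulr_suml -big_split /=.
  apply: eq_bigr => s _; rewrite !mulr_sumr -big_split /=.
  by apply: eq_bigr => t _; rewrite cosB; ring.
rewrite (eq_bigr _ (fun j _ => E j)) exchange_big /= mulr_sumr.
apply: eq_bigr => s _; rewrite exchange_big /= (bigD1 s) //=.
rewrite -mulr_sumr dft_orthogonal ?eqxx ?(leq_trans (ltn_ord _)) //.
rewrite big1 ?addr0 => [|t ts]; first by rewrite mulrC expr2.
rewrite -mulr_sumr dft_orthogonal ?(leq_trans (ltn_ord _)) //.
by rewrite eq_sym val_eqE (negbTE ts) mulr0.
Qed.

Lemma dft_inversion T (x : nat -> R) (r : nat) : (r < T)%N ->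
  T%:R * x r = \sum_(j < T)
    (dft_cos T (fun t : 'I_T => x t) j * cos (dft_angle T (j * r)) +
     dft_sin T (fun t : 'I_T => x t) j * sin (dft_angle T (j * r))).
Proof.
move=> rT; have E (j : 'I_T) :
    dft_cos T (fun t : 'I_T => x t) j * cos (dft_angle T (j * r)) +
    dft_sin T (fun t : 'I_T => x t) j * sin (dft_angle T (j * r)) =
    \sum_(t < T) x t * cos (dft_angle T (j * t) - dft_angle T (j * r)).
  rewrite /dft_cos /dft_sin !mulr_suml -big_split /=.
  by apply: eq_bigr => t _; rewrite cosB; ring.
rewrite (eq_bigr _ (fun j _ => E j)) exchange_big /= (bigD1 (Ordinal rT)) //=.
rewrite -mulr_sumr dft_orthogonal // eqxx big1 ?addr0 => [|t tr].
  by rewrite mulrC.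
by rewrite -mulr_sumr dft_orthogonal // -[r]/(val (Ordinal rT)) val_eqE
  (negbTE tr) mulr0.
Qed.

(** With [a] and [b] the cosine and sine transforms at [j], the Hartley
    transforms at [j] and [- j] are [a + b] and [a - b], and [a^2 + b^2] is the
    mean of their squares.  The frequency [- j] is represented by
    [(T - j) %% T]. *)
Lemma dft_modulus_le_cas T (x : 'I_T -> R) (M : R) (j : nat) : (j < T)%N ->
  (forall i : nat, (i < T)%N -> `|\sum_t x t * cas T (i * t)| <= M) ->
  dft_cos T x j ^+ 2 + dft_sin T x j ^+ 2 <= M ^+ 2.
Proof.
move=> jT xM; have T0 : (0 < T)%N by exact: leq_trans jT.
have plus : `|dft_cos T x j + dft_sin T x j| <= M.
  rewrite -big_split /=; apply: le_trans (xM j jT).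
  by rewrite le_eqVlt; apply/orP; left; apply/eqP; congr `|_|;
    apply: eq_bigr => t _; rewrite -mulrDr.
have minus : `|dft_cos T x j - dft_sin T x j| <= M.
  have iT : (((T - j) %% T) < T)%N by rewrite ltn_mod.
  apply: le_trans (xM _ iT); rewrite le_eqVlt; apply/orP; left; apply/eqP.
  congr `|_|; rewrite -sumrB; apply: eq_bigr => t _; rewrite -mulrBr;
    congr (_ * _).
  have shift (f : R -> R) : periodic f (pi *+ 2) ->
      f (dft_angle T ((T - j) %% T * t)) = f (- dft_angle T (j * t)).
    move=> fp; rewrite -(periodicn fp ((T - j) %/ T * t))
      -(@dft_angle_period T) //.
    rewrite -dft_angleD mulnAC -mulnDl [X in (X * t)%N]addnC -divn_eq.
    rewrite -(periodicn fp t (- _)) -(@dft_angle_period T) // mulnBl.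
    have jtT : (j * t <= T * t)%N by rewrite leq_mul2r ltnW ?orbT.
    by congr f; rewrite [(t * T)%N]mulnC -{2}(subnKC jtT) dft_angleD addKr.
  by rewrite /cas (shift _ (@cosD2pi R)) (shift _ (@sinD2pi R)) cosN sinN.
move: plus minus; set a := dft_cos _ _ _; set b := dft_sin _ _ _ => p q.
have M0 : 0 <= M by exact: le_trans p.
have p2 : (a + b) ^+ 2 <= M ^+ 2
  by rewrite -real_normK ?num_real // lerXn2r ?nnegrE.
have q2 : (a - b) ^+ 2 <= M ^+ 2
  by rewrite -real_normK ?num_real // lerXn2r ?nnegrE.
have : ((a + b) ^+ 2 + (a - b) ^+ 2) / 2 <= M ^+ 2 by lra.
by apply: le_trans; rewrite le_eqVlt; apply/orP; left; apply/eqP; field.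
Qed.

Lemma energy_le_cas T (x : 'I_T -> R) (M : R) : (0 < T)%N ->
  (forall i : nat, (i < T)%N -> `|\sum_t x t * cas T (i * t)| <= M) ->
  \sum_t x t ^+ 2 <= M ^+ 2.
Proof.
move=> T0 xM; have Tp : 0 < T%:R :> R by rewrite ltr0n.
rewrite -(ler_pM2l Tp) -(dft_parseval x (leqnn T)).
apply: (@le_trans _ _ (\sum_(j < T) M ^+ 2)).
  by apply: ler_sum => j _; exact: dft_modulus_le_cas.
by rewrite sumr_const card_ord mulr_natl.
Qed.

(** As [L + W - 1 <= T], the Hankel matrix [H] is a submatrix of a [T]-periodic
    convolution, which the Fourier transform diagonalises.  For [y = H x] the
    contribution [z j] of frequency [j] to [T <y, H x>] is at most
    [(|Y_j|^2 + M^2 |X_j|^2) / 2], so that Parseval gives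
    [|y|^2 <= (|y|^2 + M^2 |x|^2) / 2]. *)
Lemma hankel_form_le_cas T L W (om : nat -> R) (x : 'I_W -> R) (M : R) :
  (0 < T)%N -> (0 < L)%N -> (0 < W)%N -> (L + W <= T.+1)%N ->
  (forall i : nat, (i < T)%N -> `|\sum_(t < T) om t * cas T (i * t)| <= M) ->
  \sum_(s < L) (\sum_(t < W) om (t + s)%N * x t) ^+ 2 <=
  M ^+ 2 * \sum_t x t ^+ 2.
Proof.
move=> T0 L0 W0 LWT omM; have Tp : 0 < T%:R :> R by rewrite ltr0n.
pose y (s : 'I_L) := \sum_(t < W) om (t + s)%N * x t.
pose a j := dft_cos T (fun t : 'I_T => om t) j.
pose b j := dft_sin T (fun t : 'I_T => om t) j.
pose X j := dft_cos T x j ^+ 2 + dft_sin T x j ^+ 2.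
pose Y j := dft_cos T y j ^+ 2 + dft_sin T y j ^+ 2.
pose z j :=
  a j * (dft_cos T y j * dft_cos T x j - dft_sin T y j * dft_sin T x j)
  + b j * (dft_sin T y j * dft_cos T x j + dft_cos T y j * dft_sin T x j).
have yE : T%:R * \sum_s y s ^+ 2 = \sum_(j < T) z j.
  have E (j : 'I_T) : z j = \sum_s \sum_t y s * x t *
     (a j * cos (dft_angle T (j * (t + s)))
      + b j * sin (dft_angle T (j * (t + s)))).
    rewrite /z; move: (a j) (b j) => aj bj.
    rewrite /dft_cos /dft_sin !mulr_suml -sumrB -big_split /=.
    rewrite !mulr_sumr -big_split /=; apply: eq_bigr => s _.
    rewrite !mulr_sumr -sumrB -big_split /= !mulr_sumr -big_split /=.
    by apply: eq_bigr => t _; rewrite mulnDr dft_angleD cosD sinD; ring.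
  rewrite (eq_bigr _ (fun j _ => E j)) exchange_big /= mulr_sumr.
  apply: eq_bigr => s _; rewrite exchange_big /= {1}expr2 mulrA {2}/y mulr_sumr.
  apply: eq_bigr => t _; rewrite -mulr_sumr -dft_inversion; first by ring.
  by rewrite -ltnS (leq_trans _ LWT) // addnC -addnS -addSn leq_add.
have zle (j : 'I_T) : z j <= (Y j + M ^+ 2 * X j) / 2.
  have ab : a j ^+ 2 + b j ^+ 2 <= M ^+ 2 by exact: dft_modulus_le_cas.
  have X0 : 0 <= X j by rewrite addr_ge0 ?sqr_ge0.
  have Y0 : 0 <= Y j by rewrite addr_ge0 ?sqr_ge0.
  have z2 : z j ^+ 2 <= M ^+ 2 * (X j * Y j).
    apply: (@le_trans _ _ ((a j ^+ 2 + b j ^+ 2) * (X j * Y j))); last first.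
      by rewrite ler_wpM2r ?mulr_ge0.
    (* Lagrange identity *)
    rewrite -subr_ge0 (_ : _ - _ =
      (a j * (dft_sin T y j * dft_cos T x j + dft_cos T y j * dft_sin T x j)
      - b j * (dft_cos T y j * dft_cos T x j
        - dft_sin T y j * dft_sin T x j)) ^+ 2);
      first exact: sqr_ge0.
    by rewrite /z /X /Y; ring.
  have s0 : 0 <= (Y j + M ^+ 2 * X j) / 2.
    by rewrite divr_ge0 // addr_ge0 // mulr_ge0 ?sqr_ge0.
  apply: le_trans (ler_norm _) _; rewrite -(@ler_pXn2r _ 2) ?nnegrE //.
  rewrite real_normK ?num_real //; apply: le_trans z2 _.
  rewrite -subr_ge0 (_ : _ - _ = ((Y j - M ^+ 2 * X j) / 2) ^+ 2) ?sqr_ge0 //.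
  by field.
have : T%:R * \sum_s y s ^+ 2 <=
    T%:R * ((\sum_s y s ^+ 2 + M ^+ 2 * \sum_t x t ^+ 2) / 2).
  rewrite yE; apply: (le_trans (ler_sum _ (fun j _ => zle j))).
  rewrite -mulr_suml big_split /= -mulr_sumr !dft_parseval; last 2 first.
  - by rewrite -ltnS (leq_trans _ LWT) // -addn1 addnC leq_add.
  - by rewrite -ltnS (leq_trans _ LWT) // -addn1 leq_add.
  by rewrite le_eqVlt; apply/orP; left; apply/eqP; ring.
rewrite ler_pM2l //; rewrite -/(y _); set u := \sum_s _; set v := M ^+ 2 * _.
by move=> h; lra.
Qed.

End DiscreteFourier.

(** * Signals driven by noise *)

Section Signals.
Context {R : realType}.
Implicit Types (n m L T N : nat).

Lemma stateD n m (A : 'M[R]_n) (B : 'M[R]_(n, m)) (u : nat -> 'cV[R]_m)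
    (w : nat -> 'cV[R]_n) t :
  state A B 0 u w t = state A B 0 u (fun=> 0) t + state A B 0 (fun=> 0) w t.
Proof.
elim: t => [|t IH] /=; first by rewrite addr0.
by rewrite IH mulmxDr mulmx0 !addr0 !addrA [X in X + _]addrAC.
Qed.

Lemma average_state n m N (Omega : Type) (A : 'M[R]_n) (B : 'M[R]_(n, m))
    (u : nat -> 'cV[R]_m) (w : 'I_N -> nat -> Omega -> 'cV[R]_n) om t :
  (0 < N)%N ->
  average (fun i om => state A B 0 u (fun t => w i t om)) om t =
  state A B 0 u (average (fun i om t => w i t om) om) t.
Proof.
move=> N0; rewrite /average; elim: t => [|t IH] /=.
  by rewrite big1 // scaler0.
rewrite !big_split /= !scalerDr -mulmx_sumr scalemxAr IH; congr (_ + _ + _).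
by rewrite sumr_const card_ord -[X in _ *: X]scaler_nat scalerA mulVf
  ?scale1r // pnatr_eq0 -lt0n.
Qed.

Lemma state_unroll n m (A : 'M[R]_n) (B : 'M[R]_(n, m))
    (w : nat -> 'cV[R]_n) t k :
  state A B 0 (fun=> 0) w (t + k) =
  A ^+ k *m state A B 0 (fun=> 0) w t
  + \sum_(s < k) A ^+ (k - s - 1) *m w (t + s)%N.
Proof.
have mulX j : A *m A ^+ j = A ^+ j.+1 by rewrite exprS.
elim: k => [|k IH]; first by rewrite addn0 expr0 mul1mx big_ord0 addr0.
rewrite addnS /= mulmx0 addr0 IH mulmxDr mulmxA mulX -addrA; congr (_ + _).
rewrite big_ord_recr /= subSnn subnn expr0 mul1mx mulmx_sumr; congr (_ + _).
apply: eq_bigr => s _; rewrite mulmxA mulX; congr (_ ^+ _ *m _).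
by have := ltn_ord s; lia.
Qed.

Lemma submxcol_toepmx n M (A : 'M[R]_n) q (v : 'M[R]_(\sum_(i < M) n, q)) i :
  submxcol (p_ := fun=> n) (toepmx M A *m v) i =
  \sum_(s < M | (s < i)%N) A ^+ (i - s - 1) *m submxcol (p_ := fun=> n) v s.
Proof.
rewrite submxcol_blkmul [RHS]big_mkcond; apply: eq_bigr => s _.
by rewrite blk_blkmx; case: ifP => // _; rewrite mul0mx.
Qed.

(** Columnwise this is [state_unroll]: the error at time [t + k] is the free
    evolution of the error at time [t] plus the noise entering since then. *)
Lemma hankel_state n m T L (A : 'M[R]_n) (B : 'M[R]_(n, m))
    (w : nat -> 'cV[R]_n) :
  let e := state A B 0 (fun=> 0) w in
  hankel T L e = obsmx L A *m hankel1 T L e + toepmx L A *m hankel T L w.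
Proof.
move=> e; apply/(@mxcolP _ _ (fun=> n)) => k.
rewrite submxcolD submxcol_toepmx /obsmx mxcol_mul !(mxcolK (p_ := fun=> n)).
apply/matrixP => a t; rewrite mxE /e state_unroll [LHS]mxE [RHS]mxE;
  congr (_ + _).
  by rewrite !mxE; apply: eq_bigr => b _; rewrite !mxE addn0.
rewrite (big_ord_widen L (fun s => A ^+ (k - s - 1) *m w (t + s)%N)
  (ltnW (ltn_ord k))) !summxE; apply: eq_bigr => s _;
    rewrite /hankel (mxcolK (p_ := fun=> n)) !mxE.
by apply: eq_bigr => b _; rewrite !mxE.
Qed.

(** [toepmx L A] is the top-left corner of [toepmx W A]. *)
Lemma specnorm_toepmx_mono n L W (A : 'M[R]_n) : (L <= W)%N ->
  specnorm (toepmx L A) <= specnorm (toepmx W A).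
Proof.
move=> LW; apply: specnorm_le => [|v]; first exact: specnorm_ge0.
pose f (i : nat) : 'cV[R]_n :=
  if insub i is Some j then submxcol (p_ := fun _ : 'I_L => n) v j else 0.
have fE (j : 'I_L) : f j = submxcol (p_ := fun=> n) v j by rewrite /f valK.
pose v' : 'M[R]_(\sum_(i < W) n, 1) :=
  mxcol (p_ := fun=> n) (fun i : 'I_W => f i).
have fL i : (L <= i)%N -> f i = 0 by move=> Li; rewrite /f insubF // ltnNge Li.
have vN : frobnorm v' = frobnorm v.
  apply: frobnorm_eq_sqr; rewrite (frobnorm_mxcol_sqr (p_ := fun=> n)).
  rewrite (frobnorm_submxcol_sqr (p_ := fun=> n)).
  under [RHS]eq_bigr do rewrite -fE.
  rewrite (big_ord_widen W (fun i => frobnorm (f i) ^+ 2) LW) [RHS]big_mkcond.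
  apply: eq_bigr => i _; case: ifPn => //; rewrite -leqNgt => /fL ->.
  by rewrite frobnorm0 expr0n.
rewrite -vN; apply: le_trans (frobnorm_mul_specnorm_col _ _).
pose g (i : nat) := \sum_(s < i) A ^+ (i - s - 1) *m f s.
have gW (i : 'I_W) : submxcol (p_ := fun=> n) (toepmx W A *m v') i = g i.
  rewrite submxcol_toepmx /g.
  rewrite (big_ord_widen W (fun s => A ^+ (i - s - 1) *m f s)
    (ltnW (ltn_ord i))).
  by apply: eq_bigr => s _; rewrite (mxcolK (p_ := fun=> n)).
have gL (i : 'I_L) : submxcol (p_ := fun=> n) (toepmx L A *m v) i = g i.
  rewrite submxcol_toepmx /g.
  rewrite (big_ord_widen L (fun s => A ^+ (i - s - 1) *m f s)
    (ltnW (ltn_ord i))).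
  by apply: eq_bigr => s _; rewrite fE.
rewrite -(@ler_pXn2r _ 2) ?nnegrE ?frobnorm_ge0 //.
rewrite !(frobnorm_submxcol_sqr (p_ := fun=> n)).
under eq_bigr do rewrite gL; under [leRHS]eq_bigr do rewrite gW.
rewrite (big_ord_widen W (fun i => frobnorm (g i) ^+ 2) LW) big_mkcond.
by apply: ler_sum => i _; case: ifP => // _; exact: sqr_ge0.
Qed.

Definition small_spectrum n T (w : nat -> 'cV[R]_n) (M : R) : Prop :=
  forall (a : 'I_n) (i : 'I_T),
    `|\sum_(t < T) w t a ord0 * cas T (i * t)| <= M.

Lemma specnorm_hankel_small n T L (w : nat -> 'cV[R]_n) (M : R) :
  (0 < L)%N -> (L <= T)%N -> 0 <= M -> small_spectrum T w M ->
  specnorm (hankel T L w) <= Num.sqrt n%:R * M.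
Proof.
move=> L0 LT M0 wM; have T0 : (0 < T)%N by exact: leq_trans LT.
apply: specnorm_le => [|v]; first by rewrite mulr_ge0 ?sqrtr_ge0.
rewrite -(@ler_pXn2r _ 2) ?nnegrE ?mulr_ge0 ?sqrtr_ge0 ?frobnorm_ge0 //.
rewrite !exprMn (sqr_sqrtr (ler0n _ n)) (frobnorm_submxcol_sqr (p_ := fun=> n)).
have -> :
    \sum_(s < L) frobnorm (submxcol (p_ := fun=> n) (hankel T L w *m v) s) ^+ 2
    = \sum_(a < n) \sum_(s < L)
        (\sum_(t < (T - L).+1) w (t + s)%N a ord0 * v t ord0) ^+ 2.
  rewrite exchange_big /=; apply: eq_bigr => s _.
  rewrite /hankel mxcol_mul (mxcolK (p_ := fun=> n)) frobnorm_sqr.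
  apply: eq_bigr => a _; rewrite big_ord1 mxE; congr (_ ^+ 2).
  by apply: eq_bigr => t _; rewrite mxE.
have vE : frobnorm v ^+ 2 = \sum_(t < (T - L).+1) v t ord0 ^+ 2.
  by rewrite frobnorm_sqr; apply: eq_bigr => t _; rewrite big_ord1.
rewrite vE -mulrA mulr_natl -[X in _ *+ X]card_ord -sumr_const;
  apply: ler_sum => a _.
apply: (@hankel_form_le_cas _ T L (T - L).+1 (fun t => w t a ord0)
  (fun t => v t ord0)) => //.
- by rewrite addnS ltnS subnKC.
- by move=> i iT; have := wM a (Ordinal iT).
Qed.

Lemma energy_small n T (w : nat -> 'cV[R]_n) (M : R) :
  (0 < T)%N -> small_spectrum T w M ->
  \sum_(t < T) frobnorm (w t) ^+ 2 <= n%:R * M ^+ 2.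
Proof.
move=> T0 wM.
have -> : \sum_(t < T) frobnorm (w t) ^+ 2 =
  \sum_(a < n) \sum_(t < T) w t a ord0 ^+ 2.
  rewrite exchange_big; apply: eq_bigr => t _.
  by rewrite frobnorm_sqr; apply: eq_bigr => a _; rewrite big_ord1.
rewrite mulr_natl -[X in _ *+ X]card_ord -sumr_const; apply: ler_sum => a _.
apply: (@energy_le_cas _ T (fun t => w t a ord0)) => // i iT.
exact: (wM a (Ordinal iT)).
Qed.

(** The columns of [H_1(e)] are the blocks of [T_W w], so its Frobenius norm is
    at most [|T_W|] times the square root of the energy of the noise. *)
Lemma specnorm_hankel1_small n m T L (A : 'M[R]_n) (B : 'M[R]_(n, m))
    (w : nat -> 'cV[R]_n) (M : R) :
  (0 < L)%N -> (L <= T)%N -> 0 <= M -> small_spectrum T w M ->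
  specnorm (hankel1 T L (state A B 0 (fun=> 0) w)) <=
  specnorm (toepmx (T - L).+1 A) * (Num.sqrt n%:R * M).
Proof.
move=> L0 LT M0 wM; have T0 : (0 < T)%N by exact: leq_trans LT.
set W := (T - L).+1; set e := state _ _ _ _ _.
pose v : 'M[R]_(\sum_(i < W) n, 1) :=
  mxcol (p_ := fun=> n) (fun i : 'I_W => w i).
apply: le_trans (specnorm_le_frobnorm _) _.
have -> : frobnorm (hankel1 T L e) = frobnorm (toepmx W A *m v).
  apply: frobnorm_eq_sqr; rewrite frobnorm_sum_col.
  rewrite (frobnorm_submxcol_sqr (p_ := fun=> n)); apply: eq_bigr => t _.
  congr (frobnorm _ ^+ 2); rewrite submxcol_toepmx.
  have -> : col t (hankel1 T L e) = e t.
    by apply/matrixP => a b; rewrite !mxE addn0 [b]ord1.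
  rewrite /e -[X in state _ _ _ _ _ X]add0n state_unroll mulmx0 add0r.
  rewrite (big_ord_widen W (fun s => A ^+ (t - s - 1) *m w (0 + s)%N)
    (ltnW (ltn_ord t))).
  by apply: eq_bigr => s _; rewrite (mxcolK (p_ := fun=> n)).
apply: le_trans (frobnorm_mul_specnorm_col _ _) _.
rewrite ler_wpM2l ?specnorm_ge0 //.
rewrite -(@ler_pXn2r _ 2) ?nnegrE ?mulr_ge0 ?sqrtr_ge0 ?frobnorm_ge0 //.
rewrite exprMn (sqr_sqrtr (ler0n _ n)) (frobnorm_mxcol_sqr (p_ := fun=> n)).
apply: le_trans (energy_small T0 wM).
have WT : (W <= T)%N by rewrite /W -subSn // leq_subLR; lia.
rewrite (big_ord_widen T (fun t => frobnorm (w t) ^+ 2) WT) big_mkcond.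
by apply: ler_sum => i _; case: ifP => // _; exact: sqr_ge0.
Qed.

End Signals.

(** * Cost of the robust controller *)

Section Performance.
Context {R : realType}.
Implicit Types (n m L T N : nat).

(** The norm constraint on [G] makes the perturbation of the achievability
    constraint at most [gam], and [|(I + Delta)^-1| <= 1 / (1 - gam)]. *)
Lemma robust_cost_le L n m T (A : 'M[R]_n) (B : 'M[R]_(n, m)) (Q : 'M[R]_n)
    (Rm : 'M[R]_m) (u : nat -> 'cV[R]_m) (s w : nat -> 'cV[R]_n) (eps gam : R)
    (G : 'BM[R]_(L, (T - L).+1, n)) :
  (0 < L)%N -> 0 < eps ->
  (forall t, s t.+1 = A *m s t + B *m u t + w t) ->
  specnorm (hankel T L w) <= eps -> robust_feasible s eps gam G ->
  LQG_cost A B Q Rm (synthesized s u G) <= robust_objective Q Rm s u gam G.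
Proof.
move=> L0 e0 sE we [/andP[g0 g1] Gl Gn Gd Go].
have adm : admissible s G by [].
pose D : 'BM[R]_(L, n, n) := downshift R L n *m data_response w G.
have Le0 : 0 < Num.sqrt L%:R * eps by rewrite mulr_gt0 // sqrtr_gt0 ltr0n.
have Dg : specnorm D <= gam.
  apply: le_trans (specnorm_mul _ _) _.
  apply: le_trans (ler_piMl (specnorm_ge0 _) (specnorm_downshift _ _)) _.
  apply: le_trans (specnorm_data_response _ _) _.
  move: Gn; rewrite ler_pdivlMr // mulrC; apply: le_trans.
  by rewrite ler_wpM2r ?specnorm_ge0 // ler_wpM2l ?sqrtr_ge0.
rewrite /synthesized (LQG_cost_response _ _ (data_response_unitmx adm) _
  (data_response_achievable sE adm)); last exact: unitmx_1D (le_lt_trans Dg g1).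
apply: le_trans (response_cost_mul _ _ _ _ _) _.
rewrite /robust_objective mulrC ler_wpM2r ?response_cost_ge0 //.
exact: specnorm_inv_1D.
Qed.

Lemma optimal_cost_response L n m T (A : 'M[R]_n) (B : 'M[R]_(n, m))
    (Q : 'M[R]_n) (Rm : 'M[R]_m) (u : nat -> 'cV[R]_m) (x : nat -> 'cV[R]_n)
    (Phix : 'BM[R]_(L, n, n)) (Phiu : 'BM[R]_(L, m, n))
    (G : 'I_L -> 'M[R]_((T - L).+1, n)) :
  achievable A B Phix Phiu -> parametrizes x u Phix Phiu G ->
  LQG_cost A B Q Rm (Phiu *m invmx Phix) = response_cost Q Rm Phix Phiu.
Proof.
move=> [_ _ ach] [GG xE _].
have Ux : Phix \in unitmx.
  by rewrite xE; apply: data_response_unitmx; exact: admissible_blkdiag.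
rewrite (LQG_cost_response _ _ Ux (unitmx1 _ _)) ?invmx1 ?mulmx1 //.
by move: ach; rewrite mul_row_col mulNmx.
Qed.

Lemma data_responseD L p n T (s e : nat -> 'cV[R]_p)
    (G : 'BM[R]_(L, (T - L).+1, n)) :
  data_response (fun t => s t + e t) G = data_response s G + data_response e G.
Proof.
apply: blkP => i j; rewrite blkD !blk_data_response -big_split /=.
apply: eq_bigr => k _; rewrite -mulmxDl; congr (_ *m _).
by apply/matrixP => a t; rewrite !mxE.
Qed.

Section Perturbed.
Context {n m L T : nat} (A : 'M[R]_n) (B : 'M[R]_(n, m)) (Q : 'M[R]_n)
    (Rm : 'M[R]_m).
Context (u : nat -> 'cV[R]_m) (w : nat -> 'cV[R]_n) (M : R).
Context (Gs : 'I_L -> 'M[R]_((T - L).+1, n)).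
Hypotheses (L0 : (0 < L)%N) (LT : (2 * L + 1 <= T)%N) (M0 : 0 <= M).
Hypothesis wM : small_spectrum T w M.

Let x := state A B 0 u (fun=> 0).
Let e := state A B 0 (fun=> 0) w.
Let s := state A B 0 u w.
Let eps : R := Num.sqrt n%:R * M.
Let normG := specnorm (blkdiag Gs).
Let normT := specnorm (toepmx (T - L).+1 A).
Let normO := specnorm (obsmx L A).
Let rho : R := eps * normT * normG.
Let beta : R := Num.sqrt L%:R * eps * normG.

Hypotheses (GsP : forall k, in_Gamma x (Gs k)).
Hypotheses (e0 : 0 < eps) (rho_le : rho <= 1 / 2) (beta_le : beta <= 1 / 3).

Let sE : s = fun t => x t + e t.
Proof. by apply/funext => t; rewrite /s stateD. Qed.

Let LleT : (L <= T)%N. Proof. by lia. Qed.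

Let hankel1_sE k : hankel1 T L s *m Gs k = 1%:M + hankel1 T L e *m Gs k.
Proof.
rewrite -(GsP k) -mulmxDl; congr (_ *m _); rewrite sE.
by apply/matrixP => a t; rewrite !mxE.
Qed.

Lemma specnorm_candidate_pert k : specnorm (hankel1 T L e *m Gs k) <= rho.
Proof.
apply: le_trans (specnorm_mul _ _) _; rewrite /rho [eps * _]mulrC.
apply: ler_pM; rewrite ?specnorm_ge0 //; last exact: specnorm_blkdiag_ge.
exact: specnorm_hankel1_small.
Qed.

(** Correcting each block by the inverse of [H_1(xbar) G_k] restores the affine
    constraints of the noisy data. *)
Definition correction k : 'M[R]_n := invmx (1%:M + hankel1 T L e *m Gs k).
Definition candidate : 'BM[R]_(L, (T - L).+1, n) :=
  blkdiag (fun k => Gs k *m correction k).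

Let rho1 : rho < 1. Proof. by apply: le_lt_trans rho_le _; lra. Qed.
Let rho_gt0 : 0 < 1 - rho. Proof. by rewrite subr_gt0. Qed.
Let rhobeta : 0 < 1 - rho - beta.
Proof. by move: rho_le beta_le; move: rho beta => r b; lra. Qed.
Let rho0 : 0 <= rho.
Proof. by rewrite /rho !mulr_ge0 ?specnorm_ge0 ?(ltW e0). Qed.

Lemma candidateE : candidate = blkdiag Gs *m blkdiag correction.
Proof. by rewrite blkdiag_mul. Qed.

Lemma specnorm_correction : specnorm (blkdiag correction) <= (1 - rho)^-1.
Proof.
apply: specnorm_blkdiag_le => [|k]; first by rewrite invr_ge0 ltW.
by apply: specnorm_inv_1D => //; exact: specnorm_candidate_pert.
Qed.

Lemma candidate_feasible : robust_feasible s eps (beta / (1 - rho)) candidate.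
Proof.
have b0 : 0 <= beta.
  by rewrite /beta !mulr_ge0 ?sqrtr_ge0 ?specnorm_ge0 ?(ltW e0).
have Le0 : 0 < Num.sqrt L%:R * eps by rewrite mulr_gt0 // sqrtr_gt0 ltr0n.
have [cl cd co] : admissible s candidate.
  apply: admissible_blkdiag => k; rewrite /in_Gamma mulmxA hankel1_sE mulmxV //.
  by apply: unitmx_1D; exact: le_lt_trans (specnorm_candidate_pert k) _.
split=> //.
  by rewrite divr_ge0 ?(ltW rho_gt0) //= ltr_pdivrMr // mul1r -subr_gt0.
rewrite candidateE; apply: le_trans (specnorm_mul _ _) _.
rewrite -/normG (_ : _ / _ = normG / (1 - rho)).
  by rewrite ler_wpM2l ?specnorm_ge0 // specnorm_correction.
by rewrite mulrAC /beta [_ * normG]mulrC mulfK ?gt_eqF.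
Qed.

Let q : R := eps * normG * normT * L%:R * (1 + normO) * frobnorm (psdsqrt Q).

Lemma specnorm_hankel_error : specnorm (hankel T L e) <=
    normT * eps * (1 + normO).
Proof.
rewrite [hankel T L e](hankel_state T L A B w);
  apply: le_trans (specnormD _ _) _.
rewrite mulrDr mulr1 addrC; apply: lerD.
  apply: le_trans (specnorm_mul _ _) _; apply: ler_pM; rewrite ?specnorm_ge0 //.
    by apply: specnorm_toepmx_mono; lia.
  exact: specnorm_hankel_small.
apply: le_trans (specnorm_mul _ _) _; rewrite mulrC -/normO.
by rewrite ler_wpM2r ?specnorm_ge0 // specnorm_hankel1_small.
Qed.

(** The factor [L] in [q] is a [sqrt L] from [Z_L] times a [sqrt L] from the
    Frobenius norm of [I (x) Q^(1/2)]. *)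
Lemma state_cost_error :
  frobnorm (psdsqrt (Iotimes L Q) *m data_response e (blkdiag Gs)) <= q.
Proof.
apply: le_trans (frobnorm_mul_specnormr _ _) _.
rewrite psdsqrt_Iotimes // frobnorm_Iotimes.
have dE : specnorm (data_response e (blkdiag Gs)) <=
    Num.sqrt L%:R * (normT * eps * (1 + normO)) * normG.
  apply: le_trans (specnorm_data_response _ _) _.
  rewrite ler_wpM2r ?specnorm_ge0 // ler_wpM2l ?sqrtr_ge0 //.
  exact: specnorm_hankel_error.
apply: (@le_trans _ _ (Num.sqrt L%:R * frobnorm (psdsqrt Q) *
   (Num.sqrt L%:R * (normT * eps * (1 + normO)) * normG))).
  by rewrite ler_wpM2l // mulr_ge0 ?sqrtr_ge0 ?frobnorm_ge0.
rewrite le_eqVlt; apply/orP; left; apply/eqP.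
have := sqr_sqrtr (ler0n R L); rewrite /q; set r := Num.sqrt L%:R => <-; ring.
Qed.

Lemma candidate_cost :
  response_cost Q Rm (data_response s candidate) (data_response u candidate) <=
  (response_cost Q Rm (data_response x (blkdiag Gs))
     (data_response u (blkdiag Gs)) + q)
  / (1 - rho).
Proof.
rewrite candidateE {1 2}/data_response !mulmxA -!/(data_response _ _).
apply: le_trans (response_cost_mul _ _ _ _ _) _.
apply: ler_pM; rewrite ?response_cost_ge0 ?specnorm_ge0 ?specnorm_correction //.
rewrite sE data_responseD; apply: le_trans (response_costD _ _ _ _ _) _.
by rewrite lerD2l state_cost_error.
Qed.

Lemma candidate_objective :
  robust_objective Q Rm s u (beta / (1 - rho)) candidate <=
  (response_cost Q Rm (data_response x (blkdiag Gs))
     (data_response u (blkdiag Gs)) + q)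
  / (1 - rho - beta).
Proof.
rewrite /robust_objective (_ : 1 - beta / _ = (1 - rho - beta) / (1 - rho));
  last first.
  by field; rewrite gt_eqF.
rewrite invf_div.
apply: le_trans (ler_wpM2l _ candidate_cost) _; first by rewrite divr_ge0 ?ltW.
by rewrite le_eqVlt; apply/orP; left; apply/eqP; field; rewrite !gt_eqF.
Qed.

End Perturbed.

End Performance.

(** * Existence of an optimal robust controller *)

Section Existence.
Context {R : realType}.

Lemma entry_le_specnorm p q (G : 'M[R]_(p, q)) i j : `|G i j| <= specnorm G.
Proof.
pose d : 'cV[R]_q := delta_mx j ord0.
have d1 : frobnorm d = 1.
  apply/eqP; rewrite -(@eqrXn2 _ 2) ?frobnorm_ge0 // expr1n frobnorm_sqr.
  rewrite (bigD1 j) //= big_ord1 mxE !eqxx big1 ?addr0 ?expr1n // => k kj.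
  by rewrite big_ord1 mxE (negbTE kj) expr0n.
rewrite -[leRHS]mulr1 -d1; apply: le_trans (frobnorm_mul_specnorm_col _ _).
rewrite -colE -(@ler_pXn2r _ 2) ?nnegrE ?frobnorm_ge0 // real_normK
  ?num_real //.
rewrite frobnorm_sqr (bigD1 i) //= big_ord1 mxE lerDl.
by apply: sumr_ge0 => k _; rewrite big_ord1 sqr_ge0.
Qed.

Lemma frobnorm_vec_mx_le p q (v : 'rV[R]_(p * q)) :
  frobnorm (vec_mx v) <= (Num.sqrt (p%:R * q%:R)) * `|v|.
Proof.
rewrite -(@ler_pXn2r _ 2) ?nnegrE ?mulr_ge0 ?sqrtr_ge0 ?frobnorm_ge0 //.
rewrite exprMn frobnorm_sqr sqr_sqrtr ?mulr_ge0 ?ler0n //.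
apply: (@le_trans _ _ (\sum_(i < p) \sum_(j < q) `|v| ^+ 2)).
  apply: ler_sum => i _; apply: ler_sum => j _;
    rewrite mxE -real_normK ?num_real //.
  rewrite lerXn2r ?nnegrE //; rewrite [leRHS]/Num.norm /= mx_normrE.
  by apply/bigmax_geP; right => /=; exists (ord0, mxvec_index i j).
by move: (`|v| ^+ 2) => a; rewrite !sumr_const !card_ord -mulrnA
  -natrM mulr_natl mulnC.
Qed.

(** Matrices are encoded as row vectors to have compactness of bounded closed
    sets. *)
Lemma lipschitz_vec_continuous p q (F : 'M[R]_(p, q) -> R) (C : R) :
  (forall G H, `|F G - F H| <= C * frobnorm (G - H)) ->
  continuous (fun v : 'rV[R]_(p * q) => F (vec_mx v)).
Proof.
move=> FC v; apply/(@cvgrPdist_lt _ R^o _ (nbhs v)) => e e0.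
pose K := `|C| * Num.sqrt (p%:R * q%:R) + 1.
have K0 : 0 < K by rewrite ltr_wpDl ?mulr_ge0 ?sqrtr_ge0.
have near_v : \forall w \near v, `|v - w| < e / K.
  apply: (@filterS _ (nbhs v) _ (ball v (e / K))); first by move=> w;
    rewrite mx_norm_ball.
  by apply: nbhsx_ballx; rewrite divr_gt0.
apply: filterS near_v => w; rewrite ltr_pdivlMr // => vw.
apply: le_lt_trans (FC _ _) _; apply: le_lt_trans vw.
rewrite -linearB /=; apply: (@le_trans _ _ (`|C| * frobnorm (vec_mx (v - w)))).
  by rewrite ler_wpM2r ?frobnorm_ge0 ?ler_norm.
apply: (@le_trans _ _ (`|C| * (Num.sqrt (p%:R * q%:R) * `|v - w|))).
  by rewrite ler_wpM2l ?normr_ge0 ?frobnorm_vec_mx_le.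
by rewrite mulrA [leRHS]mulrC ler_wpM2r // lerDl.
Qed.

Lemma specnorm_lipschitz p q (G H : 'M[R]_(p, q)) :
  `|specnorm G - specnorm H| <= 1 * frobnorm (G - H).
Proof.
have tri (X Y : 'M[R]_(p, q)) : specnorm X - specnorm Y <= frobnorm (X - Y).
  rewrite lerBlDr -{1}(subrK Y X); apply: le_trans (specnormD _ _) _.
  by rewrite lerD2r specnorm_le_frobnorm.
by rewrite mul1r ler_norml tri andbT lerNl opprB -frobnormN opprB tri.
Qed.

Lemma frobnorm_comp_lipschitz p q r l l' (K : 'M[R]_(p, q))
    (f : 'M[R]_(r, l) -> 'M[R]_(q, l')) (Y : 'M[R]_(p, l')) :
  (forall G H, frobnorm (f G - f H) <= frobnorm (G - H)) ->
  forall G H, `|frobnorm (K *m f G - Y) - frobnorm (K *m f H - Y)| <=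
  specnorm K * frobnorm (G - H).
Proof.
move=> fC G H.
have tri (X Z : 'M[R]_(p, l')) : `|frobnorm X - frobnorm Z| <= frobnorm (X - Z).
  rewrite ler_norml ler_frobnormB andbT lerNl opprB.
  by rewrite -(frobnormN (X - Z)) opprB ler_frobnormB.
apply: le_trans (tri _ _) _.
rewrite opprB addrA subrK -mulmxBr; apply: le_trans
  (frobnorm_mul_specnorml _ _) _.
by rewrite ler_wpM2l ?specnorm_ge0.
Qed.

Lemma frobnorm_blk_le L p q (G : 'BM[R]_(L, p, q)) i j :
  frobnorm (blk G i j) <= frobnorm G.
Proof.
rewrite -(@ler_pXn2r _ 2) ?nnegrE ?frobnorm_ge0 // frobnorm_blk_sqr.
rewrite (bigD1 i) //= (bigD1 j) //= -addrA lerDl addr_ge0 ?sumr_ge0 //.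
- by move=> k _; exact: sqr_ge0.
- by move=> k _; apply: sumr_ge0 => l _; exact: sqr_ge0.
Qed.

Lemma closed_blk_eq L p q r (K : 'M[R]_(r, p)) (Y : 'M[R]_(r, q)) (i j : 'I_L) :
  closed [set v : 'rV[R]_((\sum_(i < L) p) * (\sum_(j < L) q)) |
          K *m blk (vec_mx v : 'BM[R]_(L, p, q)) i j = Y].
Proof.
rewrite (_ : [set _ | _] =
  (fun v => frobnorm (K *m blk (vec_mx v : 'BM[R]_(L, p, q)) i j
    - Y)) @^-1` [set 0]).
  apply: preimage_closed; last exact: closed_eq.
  move=> v _; apply: (@lipschitz_vec_continuous _ _
    (fun G : 'BM[R]_(L, p, q) => frobnorm (K *m blk G i j - Y)) (specnorm K)).
  apply: (@frobnorm_comp_lipschitz _ _ _ _ _ _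
    (fun G : 'BM[R]_(L, p, q) => blk G i j)).
  by move=> G H; rewrite -blkN -blkD frobnorm_blk_le.
apply/seteqP; split=> v /= => [->|/eqP]; first by rewrite subrr frobnorm0.
by rewrite frobnorm_eq0 subr_eq0 => /eqP.
Qed.

Lemma admissible_closed L n T (s : nat -> 'cV[R]_n) :
  closed [set v | admissible s (vec_mx v : 'BM[R]_(L, (T - L).+1, n))].
Proof.
pose lower (ij : 'I_L * 'I_L) := (ij.1 < ij.2)%N.
pose F1 (ij : 'I_L * 'I_L) := [set v | 1%:M *m
  blk (vec_mx v : 'BM[R]_(L, (T - L).+1, n)) ij.1 ij.2 = 0].
pose F2 (ij : 'I_L * 'I_L) := [set v | hankel1 T L s *m
  blk (vec_mx v : 'BM[R]_(L, (T - L).+1, n)) ij.1 ij.2 =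
  if ij.1 == ij.2 then 1%:M else 0].
rewrite (_ : [set _ | _] =
  \bigcap_(ij in [set ij | lower ij]) F1 ij `&` \bigcap_(ij in setT) F2 ij).
  by apply: closedI; apply: closed_bigI => ij _; exact: closed_blk_eq.
apply/seteqP; split=> v /=.
  case=> gl gd go; split=> [[i j] /= ij|[i j] _]; rewrite /F1 /F2 /=.
    by rewrite mul1mx gl.
  by case: eqVneq => [<-|]; [exact: gd | exact: go].
case=> h1 h2; split=> [i j ij|i|i j ij].
- by have := h1 (i, j) ij; rewrite /F1 /= mul1mx.
- by have := h2 (i, i) I; rewrite /F2 /= eqxx.
- by have := h2 (i, j) I; rewrite /F2 /= (negbTE ij).
Qed.

Lemma response_cost_dataE L n m T (Q : 'M[R]_n) (Rm : 'M[R]_m)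
    (s : nat -> 'cV[R]_n) (u : nat -> 'cV[R]_m) :
  exists r (K : 'M[R]_(r, \sum_(i < L) (T - L).+1)),
    forall G : 'BM[R]_(L, (T - L).+1, n),
    response_cost Q Rm (data_response s G) (data_response u G) =
      frobnorm (K *m G - 0).
Proof.
eexists; exists (
  block_mx (psdsqrt (Iotimes L Q)) 0 0 (psdsqrt (Iotimes L Rm)) *m
  col_mx (downshifts R L n *m Iotimes L (hankel T L s))
         (downshifts R L m *m Iotimes L (hankel T L u))) => G.
by rewrite subr0 -mulmxA mul_col_mx.
Qed.

(** The state response is invertible, so it is not annihilated by the nonzero
    matrix [I (x) Q^(1/2)]. *)
Lemma response_cost_gt0 L n m T (Q : 'M[R]_n) (Rm : 'M[R]_m)
    (s : nat -> 'cV[R]_n) (u : nat -> 'cV[R]_m)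
    (G : 'BM[R]_(L, (T - L).+1, n)) :
  (0 < L)%N -> psdsqrt Q != 0 -> admissible s G ->
  0 < response_cost Q Rm (data_response s G) (data_response u G).
Proof.
move=> L0 Q0 adm; rewrite lt_neqAle response_cost_ge0 andbT eq_sym.
apply: contra Q0 => /eqP c0.
have := response_cost_sqr Q Rm (data_response s G) (data_response u G).
rewrite c0 expr0n /= => /esym/eqP; rewrite paddr_eq0 ?sqr_ge0 // => /andP[+ _].
rewrite sqrf_eq0 frobnorm_eq0 psdsqrt_Iotimes // => /eqP QP.
have : Iotimes L (psdsqrt Q) = 0.
  by rewrite -(mulmxK (data_response_unitmx adm) (Iotimes L _)) QP mul0mx.
move=> /(congr1 (fun X => blk X (Ordinal L0) (Ordinal L0))).
by rewrite blk_blkdiag eqxx blk0 => ->.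
Qed.

(** For fixed [G] the best value of [gam] is [c |G|] with [c = sqrt L * eps], so
    the problem is to minimise [cost G / (1 - c |G|)].  On the sublevel set of a
    feasible point this is continuous, because the cost stays positive and keeps
    [c |G|] away from [1]; the sublevel set is compact. *)
Lemma robust_optimal_exists L n m T (Q : 'M[R]_n) (Rm : 'M[R]_m)
    (s : nat -> 'cV[R]_n) (u : nat -> 'cV[R]_m) (eps gam0 : R)
    (G0 : 'BM[R]_(L, (T - L).+1, n)) :
  (0 < L)%N -> 0 < eps -> psdsqrt Q != 0 -> robust_feasible s eps gam0 G0 ->
  exists gam G, robust_optimal Q Rm s u eps gam (G : 'BM[R]_(L, (T - L).+1, n)).
Proof.
move=> L0 e0 Q0 [/andP[g0 g1] Gl0 Gn0 Gd0 Go0].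
pose c := Num.sqrt L%:R * eps; have c0 : 0 < c
  by rewrite mulr_gt0 // sqrtr_gt0 ltr0n.
pose cost (G : 'BM[R]_(L, (T - L).+1, n)) :=
  response_cost Q Rm (data_response s G) (data_response u G).
have cost_gt0 G : admissible s G -> 0 < cost G by exact: response_cost_gt0.
have adm0 : admissible s G0 by [].
pose V := cost G0 / (1 - gam0).
have V0 : 0 < V by rewrite divr_gt0 ?subr_gt0 ?cost_gt0.
pose slack (G : 'BM[R]_(L, (T - L).+1, n)) := 1 - c * specnorm G.
have cost_cont : continuous (fun v => cost (vec_mx v)).
  have [r [K KE]] := @response_cost_dataE L n m T Q Rm s u.
  rewrite (_ : (fun v => _) = (fun v => frobnorm (K *m vec_mx v - 0)));
    last first.
    by apply/funext => v; exact: KE.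
  apply: (@lipschitz_vec_continuous _ _ (fun G => frobnorm (K *m G - 0))
    (specnorm K)).
  exact: (@frobnorm_comp_lipschitz _ _ _ _ _ K id).
have slack_cont : continuous (fun v => slack (vec_mx v)).
  apply: (@lipschitz_vec_continuous _ _ slack c) => G H.
  have -> : slack G - slack H = c * (specnorm H - specnorm G)
    by rewrite /slack; ring.
  rewrite normrM (gtr0_norm c0).
  rewrite ler_pM2l //; rewrite -[leRHS]mul1r -frobnormN opprB.
  exact: specnorm_lipschitz.
pose S := [set v | admissible s (vec_mx v)] `&`
          [set v | cost (vec_mx v) <= V * slack (vec_mx v)].
have slack_gt0 v : S v -> 0 < slack (vec_mx v).
  by case=> /cost_gt0 h /= h'; rewrite -(pmulr_rgt0 _ V0) (lt_le_trans h h').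
have Sclosed : closed S.
  apply: closedI; first exact: admissible_closed.
  rewrite (_ : [set _ | _] =
    (fun v => V * slack (vec_mx v) - cost (vec_mx v)) @^-1` [set x | 0 <= x]).
    apply: preimage_closed; last exact: closed_ge.
    move=> v _; apply: (@continuousB _ R^o _ _ _ v); last exact: cost_cont.
    by apply: continuousM; [exact: cst_continuous|exact: slack_cont].
  by apply/seteqP; split=> v /=; rewrite subr_ge0.
have Sbounded : bounded_set S.
  exists c^-1; split; first exact: num_real.
  move=> x cx v Sv /=; rewrite [leLHS]/Num.norm /= mx_normrE.
  apply/bigmax_leP; split=> [|[i k] _ /=].
    by rewrite (le_trans _ (ltW cx)) // invr_ge0 ltW.
  rewrite [i]ord1; case/mxvec_indexP: k => i' j'.
  have -> : v ord0 (mxvec_index i' j') = (vec_mx v) i' j' by rewrite mxE.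
  apply: le_trans (entry_le_specnorm _ _ _) _; apply: le_trans (ltW cx).
  have := slack_gt0 v Sv; rewrite /slack subr_gt0 => /ltW.
  by rewrite -ler_pdivlMl // mulr1.
have S0 : S (mxvec G0).
  split; rewrite /= mxvecK //.
  rewrite -[leLHS](divfK (x := 1 - gam0)) ?gt_eqF ?subr_gt0 //.
  rewrite -/V ler_pM2l // lerD2l lerN2.
  by move: Gn0; rewrite ler_pdivlMr // mulrC.
have Scompact : compact S by exact: bounded_closed_compact.
have S_neq0 : S !=set0 by exists (mxvec G0).
have [|v] := @EVT_min_rV _ _ (fun v => cost (vec_mx v) / slack (vec_mx v))
  S S_neq0 Scompact.
  rewrite continuous_subspace_in => v; rewrite inE => Sv.
  apply: continuous_subspaceT_for => //.
  apply: continuousM; first exact: cost_cont.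
  apply: continuousV; first by rewrite gt_eqF // slack_gt0.
  exact: slack_cont.
rewrite inE => Sv vmin; exists (c * specnorm (vec_mx v)), (vec_mx v).
have [[gl gd go] _] := Sv.
split.
  split=> //; last by rewrite -/c mulrAC mulfV ?mul1r ?gt_eqF.
  by rewrite mulr_ge0 ?specnorm_ge0 ?(ltW c0) //= -subr_gt0 slack_gt0.
move=> gam' G' [/andP[g0' g1'] Gl' Gn' Gd' Go'].
have adm' : admissible s G' by [].
have sl : 1 - gam' <= slack G'.
  by rewrite lerD2l lerN2; move: Gn'; rewrite ler_pdivlMr // mulrC.
have sl0 : 0 < slack G' by apply: lt_le_trans sl; rewrite subr_gt0.
rewrite /robust_objective -/(cost _) -/(cost _) mulrC.
apply: (@le_trans _ _ (cost G' / slack G')); last first.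
  rewrite mulrC ler_wpM2r ?(ltW (cost_gt0 _ adm')) // lef_pV2 ?posrE //.
  by rewrite subr_gt0.
have [SG|nSG] := leP (cost G') (V * slack G').
  by rewrite -(mxvecK G'); apply: vmin; rewrite inE; split; rewrite /= mxvecK.
apply: (@le_trans _ _ V); last by rewrite ler_pdivlMr // ltW.
by have [_ /=] := Sv; rewrite ler_pdivrMr // slack_gt0.
Qed.

End Existence.

(** * Independent Gaussian variables *)

Section Independence.
Context {R : realType}.
Import HBNNSimple.
Local Open Scope ereal_scope.

(** Two measures that agree on indicators agree on nonnegative functions, by
    monotone approximation with simple functions.  The weight [g] is the product
    of the other factors in [expectation_prod_indep], and the Gaussian density
    in [normal_mgf]. *)
Lemma ge0_integral_transfer d1 d2 d3 (X : measurableType d1)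
    (Z : measurableType d2) (V : measurableType d3)
    (mu : {measure set X -> \bar R}) (nu : {measure set Z -> \bar R})
    (g : X -> R) (Y : X -> V) (Y' : Z -> V) (c : R) (f : V -> R) :
  measurable_fun setT g -> (forall x, 0 <= g x)%R ->
  measurable_fun setT Y -> measurable_fun setT Y' -> (0 <= c)%R ->
  (forall B, measurable B -> \int[mu]_x (g x * \1_B (Y x))%:E =
     c%:E * \int[nu]_z (\1_B (Y' z))%:E) ->
  measurable_fun setT f -> (forall v, 0 <= f v)%R ->
  \int[mu]_x (g x * f (Y x))%:E = c%:E * \int[nu]_z (f (Y' z))%:E.
Proof.
move=> mg g0 mY mY' c0 on_indic mf f0.
have mEf : measurable_fun setT (EFin \o f) by exact/measurable_EFinP.
pose f_ := nnsfun_approx measurableT mEf.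
have f_cvg v : (f_ n v)%:E @[n --> \oo] --> (f v)%:E.
  by apply: (cvg_nnsfun_approx measurableT mEf) => // x _; rewrite lee_fin.
have mfn n : measurable_fun setT (f_ n) by exact: measurable_funP.
have fn0 n v : (0 <= f_ n v)%R by exact: fun_ge0.
have fn_nd v m n : (m <= n)%N -> (f_ m v <= f_ n v)%R.
  by move=> mn; exact/lefP/nd_nnsfun_approx.
have ind_ge0 n k v : (0 <= k * \1_(f_ n @^-1` [set k]) v :> R)%R.
  rewrite indicE; have [|] := boolP (v \in _); last by rewrite mulr0.
  by rewrite inE /= => <-; rewrite mulr1.
have mlevel n k : measurable (f_ n @^-1` [set k]).
  by rewrite -[_ @^-1` _]setTI; exact: mfn.
have mindX n k :
    measurable_fun setT (fun x => \1_(f_ n @^-1` [set k]) (Y x) : R).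
  by apply: measurableT_comp mY; exact: measurable_indic.
have mindZ n k :
    measurable_fun setT (fun z => \1_(f_ n @^-1` [set k]) (Y' z) : R).
  by apply: measurableT_comp mY'; exact: measurable_indic.
have level n k : \int[mu]_x (k * (g x * \1_(f_ n @^-1` [set k]) (Y x)))%:E =
    \int[nu]_z (c * (k * \1_(f_ n @^-1` [set k]) (Y' z)))%:E.
  have [k0|k0] := leP 0%R k.
    under eq_integral do rewrite EFinM.
    under [RHS]eq_integral do rewrite mulrCA EFinM.
    rewrite !ge0_integralZl_EFin //; first last.
    - by apply/measurable_EFinP; exact: measurable_funM.
    - by move=> z _; rewrite lee_fin mulr_ge0.
    - by apply/measurable_EFinP; exact: measurable_funM.
    - by move=> z _; rewrite lee_fin mulr_ge0.
    rewrite on_indic //; congr (_ * _); under [RHS]eq_integral do rewrite EFinM.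
    rewrite ge0_integralZl_EFin //; first exact/measurable_EFinP.
  have i0 v : \1_(f_ n @^-1` [set k]) v = 0%R :> R.
    rewrite indicE memNset //= => fk.
    by move: (fn0 n v); rewrite fk leNgt k0.
  by rewrite !integral0_eq // => ? _; rewrite i0 !mulr0.
have simple n : \int[mu]_x (g x * f_ n (Y x))%:E =
  \int[nu]_z (c * f_ n (Y' z))%:E.
  have E1 x : (g x * f_ n (Y x))%:E =
      \sum_(k \in range (f_ n)) (k * (g x * \1_(f_ n @^-1` [set k]) (Y x)))%:E.
    rewrite [in LHS]fimfunE mulr_fsumr -fsumEFin //.
    by apply: eq_fsbigr => k _; rewrite mulrCA.
  have E2 z : (c * f_ n (Y' z))%:E =
      \sum_(k \in range (f_ n)) (c * (k * \1_(f_ n @^-1` [set k]) (Y' z)))%:E.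
    by rewrite [in LHS]fimfunE mulr_fsumr -fsumEFin.
  under eq_integral do rewrite E1; under [RHS]eq_integral do rewrite E2.
  rewrite !ge0_integral_fsum //.
  - by apply: eq_fsbigr => k _; exact: level.
  - by move=> k; apply/measurable_EFinP; do 2!apply: measurable_funM => //.
  - by move=> k z _; rewrite lee_fin mulr_ge0.
  - by move=> k; apply/measurable_EFinP; do 2!apply: measurable_funM => //.
  - by move=> k x _; rewrite lee_fin mulrCA mulr_ge0.
have mfY : measurable_fun setT (fun z => f (Y' z))
  by exact: measurableT_comp mY'.
rewrite -ge0_integralZl_EFin //; first last.
- exact/measurable_EFinP.
- by move=> z _; rewrite lee_fin.
transitivity (limn (fun n => \int[mu]_x (g x * f_ n (Y x))%:E)).
  rewrite -monotone_convergence //.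
  - apply: eq_integral => x _; apply/esym/cvg_lim => //.
    by under eq_fun do rewrite EFinM; rewrite EFinM; apply: cvgeZl.
  - move=> n; apply/measurable_EFinP; apply: measurable_funM => //.
    exact: measurableT_comp mY.
  - by move=> n x _; rewrite lee_fin mulr_ge0.
  - by move=> x _ m n mn; rewrite lee_fin ler_wpM2l ?fn_nd.
under eq_fun do rewrite simple.
rewrite -monotone_convergence //.
- apply: eq_integral => z _; apply/cvg_lim => //.
  by under eq_fun do rewrite EFinM; apply: cvgeZl.
- move=> n; apply/measurable_EFinP; apply: measurable_funM => //.
  exact: measurableT_comp mY'.
- by move=> n z _; rewrite lee_fin mulr_ge0.
- by move=> z _ m n mn; rewrite lee_fin ler_wpM2l ?fn_nd.
Qed.

(** Starting from indicators, for which the product rule is the definition of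
    independence, one factor at a time is replaced by a general function. *)
Lemma expectation_prod_indep d (Omega : measurableType d)
    (P : probability Omega R)
    (I : finType) (Y : I -> Omega -> R) (f : I -> R -> R) (e : I -> R) :
  (forall i, measurable_fun setT (Y i)) ->
  (forall B : I -> set R, (forall i, measurable (B i)) ->
     P [set om | forall i, B i (Y i om)] = \prod_i P (Y i @^-1` B i)) ->
  (forall i, measurable_fun setT (f i)) -> (forall i x, 0 <= f i x)%R ->
  (forall i, \int[P]_om (f i (Y i om))%:E = (e i)%:E) ->
  \int[P]_om (\prod_i f i (Y i om))%:E = (\prod_i e i)%:E.
Proof.
move=> mY indep.
have mpre i B : measurable B -> measurable (Y i @^-1` B).
  by move=> mB; rewrite -[_ @^-1` _]setTI; exact: mY.
have indicY i B om : \1_B (Y i om) = \1_(Y i @^-1` B) om :> R.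
  by rewrite !indicE; congr (_%:R); congr (nat_of_bool _); apply/idP/idP;
    rewrite !inE.
pose claim (K : {set I}) := forall (f : I -> R -> R) (e : I -> R),
  (forall i, i \notin K -> exists2 B, measurable B & f i = \1_B) ->
  (forall i, measurable_fun setT (f i)) -> (forall i x, 0 <= f i x)%R ->
  (forall i, \int[P]_om (f i (Y i om))%:E = (e i)%:E) ->
  \int[P]_om (\prod_i f i (Y i om))%:E = (\prod_i e i)%:E.
suff all_claims m (K : {set I}) : #|K| = m -> claim K.
  move=> mf f0 fe; apply: (all_claims _ [set: I]%SET erefl) => // i.
  by rewrite finset.inE.
elim: m K => [|m IH] K cK {f e} f e fK mf f0 fe.
  have /choice[B BP] : forall i, exists B, measurable B /\ f i = \1_B.
    move=> i; have [|B mB fB] := fK i; last by exists B.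
    by move/eqP: cK; rewrite cards_eq0 => /eqP ->; rewrite finset.inE.
  have eP i : (e i)%:E = P (Y i @^-1` B i).
    rewrite -fe (BP i).2; under eq_integral do rewrite indicY.
    by rewrite integral_indic ?setIT //; apply: mpre; have [] := BP i.
  have prodE om : (\prod_i f i (Y i om))%R =
    \1_[set om | forall i, B i (Y i om)] om.
    have [omB|omB] := pselect (forall i, B i (Y i om)).
      by rewrite indicE mem_set // big1 // => i _;
        rewrite (BP i).2 indicE mem_set.
    have [i nB] : exists i, ~ B i (Y i om) by apply/existsNP.
    by rewrite [RHS]indicE memNset // (bigD1 i) //=
      (BP i).2 indicE memNset // mul0r.
  under eq_integral do rewrite prodE.
  have mcap : measurable [set om | forall i, B i (Y i om)].
    rewrite (_ : [set _ | _] = \big[setI/setT]_(i : I) (Y i @^-1` B i)).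
      by apply: bigsetI_measurable => i _; apply: mpre; have [] := BP i.
    rewrite -bigcap_seq; apply/seteqP; split=> om /= omB.
      by move=> i _; exact: omB.
    by move=> i; apply: omB; rewrite /= mem_index_enum.
  transitivity (P [set om | forall i, B i (Y i om)]).
    by rewrite integral_indic // setIT.
  rewrite indep; last by move=> i; exact: (BP i).1.
  by rewrite -prodEFin; apply: eq_bigr => i _; rewrite eP.
have [k kK] : exists k, k \in K by apply/set0Pn; rewrite -card_gt0 cK.
pose g om := (\prod_(i | i != k) f i (Y i om))%R.
pose c := (\prod_(i | i != k) e i)%R.
have e0 i : (0 <= e i)%R.
  by rewrite -lee_fin -fe; apply: integral_ge0 => om _; rewrite lee_fin.
have mfY i : measurable_fun setT (fun om => f i (Y i om))
  by exact: measurableT_comp.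
transitivity (c%:E * \int[P]_om (f k (Y k om))%:E); last first.
  by rewrite fe -EFinM [in RHS](bigD1 k) //= mulrC.
under eq_integral do rewrite (bigD1 k) //= mulrC -/(g _).
apply: ge0_integral_transfer => //.
- rewrite /g; under eq_fun do rewrite -big_filter.
  by apply: measurable_prod => i _.
- by move=> om; apply: prodr_ge0.
- by apply: prodr_ge0.
move=> B mB.
have eB : \int[P]_om (\1_B (Y k om))%:E = (fine (P (Y k @^-1` B)))%:E.
  under eq_integral do rewrite indicY.
  by rewrite integral_indic ?setIT ?fineK ?fin_num_measure //; exact: mpre.
have := IH (K :\ k)%SET _ (fun i => if i == k then \1_B else f i)
  (fun i => if i == k then fine (P (Y k @^-1` B)) else e i).
have -> : \int[P]_om (\prod_i (if i == k then \1_B else f i) (Y i om))%:E =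
    \int[P]_om (g om * \1_B (Y k om))%:E.
  apply: eq_integral => om _; rewrite (bigD1 k) //= eqxx mulrC;
    congr ((_ * _)%:E).
  by apply: eq_bigr => i /negbTE ->.
rewrite (bigD1 k) //= eqxx mulrC eB -EFinM => ->.
- congr (_ * _)%:E; apply: eq_bigr => i /negbTE -> //.
- by move: cK; rewrite (cardsD1 k) kK => -[].
- move=> i; rewrite !finset.inE negb_and negbK; case: eqP => /= [_ _|_ iK].
    by exists B.
  exact: fK.
- by move=> i; case: ifP => // _; exact: measurable_indic.
- by move=> i x; case: ifP => // _; rewrite indicE.
- by move=> i; case: eqP => // ->.
Qed.

End Independence.

Section Gaussian.
Context {R : realType}.
Local Open Scope ereal_scope.

(** Completing the square turns the integrand into a multiple of the density
    with mean [a * s ^+ 2]. *)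
Lemma integral_normal_mgf (s a : R) : (0 < s)%R ->
  \int[lebesgue_measure]_x (normal_pdf 0 s x * expR (a * x))%:E =
  (expR (a ^+ 2 * s ^+ 2 / 2))%:E.
Proof.
move=> s0; have sn0 : s != 0%R by rewrite gt_eqF.
have E x : (normal_pdf 0 s x * expR (a * x))%:E =
    (expR (a ^+ 2 * s ^+ 2 / 2))%:E * (normal_pdf (a * s ^+ 2) s x)%:E.
  rewrite -EFinM !normal_pdfE // /normal_fun; congr EFin.
  rewrite -[LHS]mulrA -expRD [RHS]mulrCA -expRD; congr (_ * expR _)%R.
  by field.
under eq_integral do rewrite E.
rewrite ge0_integralZl_EFin ?expR_ge0 ?integral_normal_pdf ?mule1 //.
- by move=> x _; rewrite lee_fin normal_pdf_ge0.
- by apply/measurable_EFinP; exact: measurable_normal_pdf.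
Qed.

Section Chernoff.
Context d (Omega : measurableType d) (P : probability Omega R) (I : finType).
Context (Y : I -> Omega -> R) (s : R) (s0 : (0 < s)%R).
Hypothesis mY : forall i, measurable_fun setT (Y i).
Hypothesis lawY : forall i B, measurable B ->
  P (Y i @^-1` B) = normal_prob 0 s B.
Hypothesis indepY : forall B : I -> set R, (forall i, measurable (B i)) ->
  P [set om | forall i, B i (Y i om)] = \prod_i P (Y i @^-1` B i).

Lemma normal_mgf i (a : R) :
  \int[P]_om (expR (a * Y i om))%:E = (expR (a ^+ 2 * s ^+ 2 / 2))%:E.
Proof.
rewrite -integral_normal_mgf // -[LHS]mul1e; apply/esym.
apply: (@ge0_integral_transfer _ _ _ _ _ _ _ lebesgue_measure P
  (normal_pdf 0 s) id
  (Y i) 1 (fun x => expR (a * x))) => //.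
- exact: measurable_normal_pdf.
- by move=> x; exact: normal_pdf_ge0.
- exact: mY.
- move=> B mB; rewrite mul1e.
  have E om : (\1_B (Y i om))%:E = (\1_(Y i @^-1` B) om)%:E :> \bar R.
    by rewrite !indicE; congr (_%:R%:E); congr (nat_of_bool _); apply/idP/idP;
      rewrite !inE.
  under [RHS]eq_integral do rewrite E.
  transitivity (P (Y i @^-1` B)); last first.
    by rewrite integral_indic ?setIT // -[_ @^-1` _]setTI; exact: mY.
  rewrite lawY // /normal_prob [RHS]integral_mkcond; apply: eq_integral => x _.
  by rewrite patchE indicE; case: ifP; rewrite ?mulr1 ?mulr0.
- by apply: measurableT_comp => //; exact: measurable_funM.
Qed.

Lemma measurable_lincomb (c : I -> R) :
  measurable_fun setT (fun om => \sum_i c i * Y i om)%R.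
Proof. by apply: measurable_sum => i; apply: measurable_funM. Qed.

Lemma lincomb_mgf (c : I -> R) :
  \int[P]_om (expR (\sum_i c i * Y i om)%R)%:E =
  (expR (s ^+ 2 * (\sum_i c i ^+ 2) / 2))%:E.
Proof.
under eq_integral do rewrite expR_sum.
rewrite (@expectation_prod_indep _ _ _ _ _ Y (fun i x => expR (c i * x))
  (fun i => expR (c i ^+ 2 * s ^+ 2 / 2))) //.
- rewrite -expR_sum; congr (expR _)%:E; rewrite mulr_sumr mulr_suml.
  by apply: eq_bigr => i _; rewrite [(c i ^+ 2 * _)%R]mulrC.
- move=> i; apply: measurableT_comp => //; exact: measurable_funM.
- by move=> i; exact: normal_mgf.
Qed.

(** Chernoff bound, with the optimal exponent [M / v]. *)
Lemma lincomb_tail (c : I -> R) (v M : R) :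
  (s ^+ 2 * \sum_i c i ^+ 2 = v)%R -> (0 < v)%R -> (0 < M)%R ->
  P [set om | M <= \sum_i c i * Y i om]%R <= (expR (- (M ^+ 2 / (2 * v))))%:E.
Proof.
move=> vE v0 M0; pose l := (M / v)%R.
have l0 : (0 < l)%R by exact: divr_gt0.
pose S om := (\sum_i c i * Y i om)%R.
have mS : measurable_fun setT S by exact: measurable_lincomb.
have mA : measurable [set om | M <= S om]%R.
  by rewrite -[X in measurable X]setTI; apply: measurable_fun_le => //;
    exact: measurable_cst.
have : (expR (l * M))%:E * P [set om | M <= S om]%R <=
    \int[P]_om (expR (l * S om))%:E.
  have -> : P [set om | M <= S om]%R =
    \int[P]_om (\1_[set om | M <= S om]%R om)%:E.
    by rewrite integral_indic // setIT.
  rewrite -ge0_integralZl_EFin ?expR_ge0 //; last first.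
    by apply/measurable_EFinP; exact: measurable_indic.
  apply: ge0_le_integral => //.
  - by apply/measurable_EFinP/measurable_funM => //; exact: measurable_indic.
  - by apply/measurable_EFinP; apply: measurableT_comp => //;
    exact: measurable_funM.
  - move=> om _; rewrite -EFinM lee_fin indicE.
    have [MS|MS] := pselect (M <= S om)%R.
      by rewrite mem_set // mulr1 ler_expR ler_pM2l.
    by rewrite memNset // mulr0 expR_ge0.
have -> : \int[P]_om (expR (l * S om))%:E = (expR (l ^+ 2 * v / 2))%:E.
  have E om : (l * S om = \sum_i (l * c i) * Y i om)%R.
    by rewrite mulr_sumr; apply: eq_bigr => i _; rewrite mulrA.
  under eq_integral do rewrite E.
  rewrite lincomb_mgf; congr (expR _)%:E; rewrite -vE.
  under eq_bigr do rewrite exprMn.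
  by rewrite -mulr_sumr; ring.
rewrite -lee_pdivlMl ?expR_gt0 // => /le_trans; apply.
rewrite -EFinM lee_fin -expRN -expRD ler_expR le_eqVlt; apply/orP; left;
  apply/eqP.
by rewrite /l; field; rewrite gt_eqF.
Qed.

End Chernoff.

End Gaussian.

(** * The high-probability event *)

Section GoodEvent.
Context {R : realType}.
Local Open Scope ereal_scope.

Lemma measure_bigsetU_le d (Omega : measurableType d) (P : probability Omega R)
    (I : Type) (r : seq I) (A : I -> set Omega) :
  (forall i, measurable (A i)) ->
  P (\big[setU/set0]_(i <- r) A i) <= \sum_(i <- r) P (A i).
Proof.
move=> mA; elim: r => [|i r IH]; first by rewrite !big_nil measure0.
rewrite !big_cons; apply: (le_trans (measureU2 _ (mA i) _)).
  by apply: bigsetU_measurable => j _; exact: mA.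
by rewrite leeD2l.
Qed.

Context {d : measure_display} {Omega : measurableType d}
    (P : probability Omega R).
Context {n T N : nat} (sigma : R) (w : 'I_N -> nat -> Omega -> 'cV[R]_n).
Hypothesis gaussian :
  forall (i : 'I_N) (t : 'I_T), isotropic_gaussian P sigma (w i t).
Hypothesis indep : mutually_independent P (fun it : 'I_N * 'I_T => w it.1 it.2).

Let Y (a : 'I_n) (it : 'I_N * 'I_T) : Omega -> R := coords (w it.1 it.2) a.

Let mY a it : measurable_fun setT (Y a it).
Proof. by have [+ _] := gaussian it.1 it.2; exact. Qed.

Lemma law_coord a it B : measurable B ->
  P (Y a it @^-1` B) = normal_prob 0 sigma B.
Proof.
move=> mB; have [_ law] := gaussian it.1 it.2.
pose S (k : 'I_n) : set R := if k == a then B else setT.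
have -> : Y a it @^-1` B = [set om | forall k, S k (coords (w it.1 it.2) k om)].
  apply/seteqP; split=> om /= h.
    by move=> k; rewrite /S; case: eqP => [->|].
  by have := h a; rewrite /S eqxx.
rewrite law => [|k]; last by rewrite /S; case: ifP.
rewrite (bigD1 a) //= /S eqxx big1 ?mule1 // => k /negbTE ->.
exact: probability_setT.
Qed.

Lemma indep_coord a (B : 'I_N * 'I_T -> set R) :
  (forall it, measurable (B it)) ->
  P [set om | forall it, B it (Y a it om)] = \prod_it P (Y a it @^-1` B it).
Proof.
move=> mB; have := indep (J := [set: 'I_N * 'I_T]%SET)
  (E := fun it => Y a it @^-1` B it).
have -> : [set om | forall it, it \in [set: 'I_N * 'I_T]%SET ->
      (Y a it @^-1` B it) om] =
    [set om | forall it, B it (Y a it om)].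
  apply/seteqP; split=> om /= h it; last by move=> _; exact: h.
  by apply: h; rewrite finset.inE.
move=> ->; first by apply: eq_bigl => it; rewrite finset.inE.
move=> it _; apply: sub_sigma_algebra; rewrite (bigD1 a) //=; left.
by exists (B it) => //; rewrite setTI.
Qed.

Hypotheses (n0 : (0 < n)%N) (T0 : (0 < T)%N) (N0 : (0 < N)%N).
Hypothesis sigma0 : (0 < sigma)%R.

(** The averaged noise has Hartley transforms of variance [sigma^2 T / N]; the
    union bound over the [n T] of them costs the factor inside the logarithm. *)
Lemma small_spectrum_event (delta : R) : (0 < delta < 1)%R ->
  let M := Num.sqrt
    (2 * (sigma ^+ 2 * T%:R / N%:R) * ln (2 * n%:R * T%:R / delta)) in
  exists E : set Omega, [/\ measurable E, (1 - delta)%:E <= P E &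
    forall om, E om ->
      small_spectrum T (average (fun i om t => w i t om) om) M].
Proof.
move=> /andP[d0 d1] M.
have nR : (1 <= n%:R :> R)%R by rewrite ler1n.
have TR : (1 <= T%:R :> R)%R by rewrite ler1n.
have NR : (0 < N%:R :> R)%R by rewrite ltr0n.
set v := (sigma ^+ 2 * T%:R / N%:R)%R in M *.
set q := (2 * n%:R * T%:R / delta)%R in M *.
have v0 : (0 < v)%R by rewrite /v divr_gt0 // mulr_gt0 ?exprn_gt0 //
  (lt_le_trans _ TR).
have q1 : (1 < q)%R.
  rewrite /q ltr_pdivlMr // mul1r; apply: lt_le_trans d1 _.
  by rewrite -mulrA mulr_ege1 ?mulr_ege1 // ler1n.
have l0 : (0 < ln q)%R by rewrite ln_gt0.
have vq0 : (0 < 2 * v * ln q)%R by apply: mulr_gt0 => //; exact: mulr_gt0.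
have M0 : (0 < M)%R by rewrite /M sqrtr_gt0.
have M2 : (M ^+ 2 / (2 * v) = ln q)%R.
  by rewrite /M sqr_sqrtr ?ltW // mulrAC mulfV ?mul1r // gt_eqF // mulr_gt0.
pose c (s : R) (j : nat) (it : 'I_N * 'I_T) : R :=
  (s * (N%:R^-1 * cas T (j * it.2)))%R.
have cv s j : (s ^+ 2 = 1 -> sigma ^+ 2 * \sum_it c s j it ^+ 2 = v)%R.
  move=> s1; have -> : (\sum_it c s j it ^+ 2 = N%:R^-1 ^+ 2 * (N%:R * T%:R))%R.
    rewrite -(pair_big_dep xpredT (fun _ _ => true)
      (fun i t => c s j (i, t) ^+ 2)%R) /=.
    rewrite -[X in (_ * (_ * X))%R](@sum_cas_sqr R T j) // mulr_natl mulrnAr.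
    rewrite -[X in (_ *+ X)%R]card_ord -sumr_const; apply: eq_bigr => i _.
    rewrite mulr_sumr; apply: eq_bigr => t _.
    by rewrite /c !exprMn s1 mul1r.
  by rewrite /v; field; rewrite gt_eqF.
pose bad (aj : 'I_n * 'I_T) (s : R) :=
  [set om | M <= \sum_it c s aj.2 it * Y aj.1 it om]%R.
have mbad aj s : measurable (bad aj s).
  rewrite -[bad _ _]setTI; apply: measurable_fun_le => //.
  by apply: measurable_lincomb => it; exact: mY.
have Pbad aj s : (s ^+ 2 = 1)%R -> P (bad aj s) <= (q^-1)%:E.
  move=> s1; have := @lincomb_tail _ _ _ P _ (Y aj.1) sigma sigma0 (mY aj.1)
    (fun it B => law_coord aj.1 it (B := B)) (@indep_coord aj.1)
    (c s aj.2) v M (cv s aj.2 s1) v0 M0.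
  by rewrite M2 expRN lnK // posrE (lt_trans ltr01).
pose A aj := bad aj 1%R `|` bad aj (- 1)%R.
have mA aj : measurable (A aj) by exact: measurableU.
have PA aj : P (A aj) <= (2 * q^-1)%:E.
  apply: (le_trans (measureU2 _ (mbad _ _) (mbad _ _))).
  rewrite mulrDl !mul1r EFinD; apply: leeD; apply: Pbad;
    first by rewrite expr1n.
  by rewrite sqrrN expr1n.
pose U := \big[setU/set0]_(aj : 'I_n * 'I_T) A aj.
have mU : measurable U by apply: bigsetU_measurable.
have PU : P U <= delta%:E.
  apply: le_trans (measure_bigsetU_le _ _ mA) _.
  apply: (@le_trans _ _ (\sum_(aj : 'I_n * 'I_T) (2 * q^-1)%:E)).
    by apply: lee_sum => aj _; exact: PA.
  rewrite sumEFin lee_fin sumr_const card_prod !card_ord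
    -[leLHS]mulr_natl natrM.
  have qE : (q * delta = 2 * n%:R * T%:R)%R by rewrite /q divfK // gt_eqF.
  rewrite mulrA ler_pdivrMr; last exact: lt_trans q1.
  by rewrite [leRHS]mulrC qE le_eqVlt; apply/orP; left; apply/eqP; ring.
exists (~` U); split; first exact: measurableC.
  rewrite probability_setC // EFinB; apply: leeB => //.
move=> om nU a j.
have nA s : (s = 1 \/ s = - 1)%R -> (\sum_it c s j it * Y a it om < M)%R.
  move=> s1; rewrite ltNge; apply/negP => h; apply: nU.
  rewrite /U (bigD1 (a, j)) //=; left; rewrite /A.
  by case: s1 h => ->; [left|right].
have E s : (\sum_it c s j it * Y a it om =
    s * \sum_(t < T)
      average (fun i om t => w i t om) om t a ord0 * cas T (j * t))%R.
  rewrite -(pair_big_dep xpredT (fun _ _ => true)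
    (fun i t => c s j (i, t) * Y a (i, t) om)%R) /=.
  rewrite exchange_big /= mulr_sumr; apply: eq_bigr => t _.
  rewrite /average mxE summxE -mulrA [in RHS]mulr_suml !mulr_sumr.
  by apply: eq_bigr => i _; rewrite /c /Y /coords; ring.
have := nA 1%R (or_introl erefl); have := nA (- 1)%R (or_intror erefl).
rewrite !E mul1r mulN1r ltrNl => h1 h2.
by rewrite ler_norml !ltW.
Qed.

End GoodEvent.

(** * The suboptimality bound *)

Section Main.
Context {R : realType}.

(** Under the zero input a disturbance evolves by powers of [A]. *)
Lemma open_loop_achievable (L n m : nat) (A : 'M[R]_n) (B : 'M[R]_(n, m)) :
  achievable A B
    (blkmx (fun i j : 'I_L => if (j <= i)%N then A ^+ (i - j) else 0))
    (0 : 'BM[R]_(L, m, n)).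
Proof.
split=> [i j ij|i j _|]; first by rewrite blk_blkmx leqNgt ij.
  by rewrite blk0.
rewrite mul_row_col mulmx0 addr0; apply: blkP => i j.
rewrite mulmxBl mul1mx -mulmxA blkD blkN blk_blkmx blk1 blk_downshiftl.
have mulX k : A *m A ^+ k = A ^+ k.+1 by rewrite exprS.
have [k /eqP ik|none] := pickP (fun k : 'I_L => i == k.+1 :> nat).
  have uniq_k (l : 'I_L) : (i == l.+1 :> nat) = (l == k).
    by rewrite ik eqSS -val_eqE eq_sym.
  rewrite (big_pred1 k) => [|l]; last exact: uniq_k.
  rewrite blk_Iotimesl blk_blkmx ik; have [jk|kj] := leqP j k.
    rewrite (leqW jk) subSn // mulX subrr; case: eqP => // ij.
    by move: jk; rewrite -ij ik ltnn.
  rewrite mulmx0 subr0; case: (ltngtP j k.+1) => [|jk|jk].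
  - by rewrite ltnS leqNgt kj.
  - by case: eqP => // ij; move: jk; rewrite -ij ik ltnn.
  - by rewrite jk subnn expr0; case: eqP => // ij; case: ij; apply: val_inj;
    rewrite /= ik jk.
rewrite big_pred0 // subr0.
have i0 : i = 0%N :> nat.
  case iE : (i : nat) => [//|l]; have lL : (l < L)%N by rewrite ltnW // -iE.
  by have := none (Ordinal lL); rewrite /= iE eqxx.
by rewrite i0 leqn0 sub0n expr0 -val_eqE /= i0 eq_sym.
Qed.

(** The zero input is achievable, and it costs nothing when [Q^(1/2) = 0]. *)
Lemma optimal_cost_eq0 (L n m : nat) (A : 'M[R]_n) (B : 'M[R]_(n, m))
    (Q : 'M[R]_n) (Rm : 'M[R]_m)
    (Phix : 'BM[R]_(L, n, n)) (Phiu : 'BM[R]_(L, m, n)) :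
  (0 < L)%N -> psdsqrt Q = 0 -> optimal_response A B Q Rm Phix Phiu ->
  response_cost Q Rm Phix Phiu = 0.
Proof.
move=> L0 Q0 [_ opt]; apply/eqP; rewrite eq_le response_cost_ge0 andbT.
apply: le_trans (opt _ _ (open_loop_achievable _ _ _)) _.
have SQ0 : psdsqrt (Iotimes L Q) = 0.
  rewrite psdsqrt_Iotimes // Q0; apply: blkP => i j; rewrite blk0 blk_blkdiag.
  by case: ifP.
rewrite -(@ler_pXn2r _ 2) ?nnegrE ?response_cost_ge0 // response_cost_sqr SQ0.
by rewrite mul0mx mulmx0 !frobnorm0 expr0n addr0.
Qed.

Lemma robust_objective_ge0 (L n m T : nat) (Q : 'M[R]_n) (Rm : 'M[R]_m)
    (s : nat -> 'cV[R]_n) (u : nat -> 'cV[R]_m) (eps gam : R)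
    (G : 'BM[R]_(L, (T - L).+1, n)) :
  robust_feasible s eps gam G -> 0 <= robust_objective Q Rm s u gam G.
Proof.
case=> /andP[_ g1] _ _ _ _.
by rewrite /robust_objective mulr_ge0 ?response_cost_ge0 // invr_ge0 subr_ge0
  ltW.
Qed.

(** The constant [6] comes from [1 - rho - beta >= 1 / 6]. *)
Lemma relative_gap (J Jh q rho beta : R) :
  0 < J -> 0 <= q -> 0 <= rho -> 0 <= beta -> rho <= 1 / 2 -> beta <= 1 / 3 ->
  Jh <= (J + q) / (1 - rho - beta) ->
  (Jh - J) / J <= 6 * (rho + 2 * beta + q / J).
Proof.
move=> J0 q0 r0 b0 r1 b1.
have D0 : 0 < 1 - rho - beta by lra.
rewrite ler_pdivlMr // => h; rewrite ler_pdivrMr //.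
have -> : 6 * (rho + 2 * beta + q / J) * J = 6 * ((rho + 2 * beta) * J + q).
  by field; rewrite gt_eqF.
rewrite -(ler_pM2r D0); apply: (@le_trans _ _ (q + J * (rho + beta))).
  by rewrite mulrBl; apply: (@le_trans _ _ ((J + q) - J * (1 - rho - beta)));
    lra.
have k0 : 0 <= (rho + 2 * beta) * J + q
  by rewrite addr_ge0 ?mulr_ge0 ?addr_ge0 ?mulr_ge0 // ltW.
have k1 : 1 <= 6 * (1 - rho - beta) by lra.
apply: (@le_trans _ _ (1 * ((rho + 2 * beta) * J + q))).
  by rewrite mul1r addrC lerD2r mulrC ler_pM2r //; lra.
by rewrite [leRHS]mulrAC ler_wpM2r.
Qed.

Lemma noise_levelE (n T N : nat) (sigma delta : R) :
  noise_level n T N sigma delta = Num.sqrt n%:R *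
    Num.sqrt (2 * (sigma ^+ 2 * T%:R / N%:R) * ln (2 * n%:R * T%:R / delta)).
Proof.
rewrite /noise_level -sqrtrM ?ler0n //; congr Num.sqrt.
set l := ln _; set i := N%:R^-1; ring.
Qed.

End Main.

Theorem corollary1 (R : realType) (d : measure_display)
    (Omega : measurableType d) (P : probability Omega R)
    (n m L T N : nat)
    (A : 'M[R]_n) (B : 'M[R]_(n, m)) (Q : 'M[R]_n) (Rm : 'M[R]_m)
    (sigma delta : R)
    (u : nat -> 'cV[R]_m)
    (w : 'I_N -> nat -> Omega -> 'cV[R]_n)
    (Phixs : 'BM[R]_(L, n, n)) (Phius : 'BM[R]_(L, m, n))
    (Gs : 'I_L -> 'M[R]_((T - L).+1, n)) :
  let x := state A B 0 u (fun=> 0) in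
  let xtilde (i : 'I_N) (om : Omega) := state A B 0 u (fun t => w i t om) in
  let xbar := average xtilde in
  let eps := noise_level n T N sigma delta in
  let Jstar := LQG_cost A B Q Rm (Phius *m invmx Phixs) in
  let normG := specnorm (blkdiag Gs) in
  let normT := specnorm (toepmx (T - L).+1 A) in
  (0 < n)%N -> (0 < m)%N -> (0 < L)%N -> (0 < N)%N ->
  controllable A B ->
  psdmx Q -> psdmx Rm ->
  persistently_exciting T (n + L) u ->
  0 < sigma ->
  (forall (i : 'I_N) (t : 'I_T), isotropic_gaussian P sigma (w i t)) ->
  mutually_independent P (fun it : 'I_N * 'I_T => w it.1 it.2) ->
  optimal_response A B Q Rm Phixs Phius ->
  minimal_parameter x u Phixs Phius Gs ->
  0 < delta < 1 ->
  (2 * L + 1 <= T)%N ->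
  2 * sigma ^+ 2 * n%:R * T%:R * ln (2 * n%:R * T%:R / delta) *
    Num.max (9 * L%:R * normG ^+ 2) (4 * normG ^+ 2 * normT ^+ 2) <= N%:R ->
  exists E : set Omega,
    [/\ measurable E, ((1 - delta)%:E <= P E)%E &
    forall om, E om ->
      (exists (gamh : R) (Gh : 'BM[R]_(L, (T - L).+1, n)),
          robust_optimal Q Rm (xbar om) u eps gamh Gh) /\
      (forall (gamh : R) (Gh : 'BM[R]_(L, (T - L).+1, n)),
          robust_optimal Q Rm (xbar om) u eps gamh Gh ->
          let Jhat := LQG_cost A B Q Rm (synthesized (xbar om) u Gh) in
          (Jhat - Jstar) / Jstar <=
          6 * normG *
          Num.sqrt (2 * sigma ^+ 2 * n%:R * T%:R / N%:R *
                    ln (2 * n%:R * T%:R / delta)) *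
          (2 * Num.sqrt L%:R +
           normT * (1 + L%:R * (1 + specnorm (obsmx L A)) *
                        frobnorm (psdsqrt Q) / Jstar)))].
Proof.
move=> x xtilde xbar eps Jstar normG normT n0 m0 L0 N0 _ _ _ _ s0 gaussian
  indep.
move=> opt [par _] d01 LT Nlarge.
have T0 : (0 < T)%N by lia.
have LleT : (L <= T)%N by lia.
have [E [mE PE EP]] := small_spectrum_event gaussian indep n0 T0 N0 s0 d01.
exists E; split => // om /EP; set wb := average _ om; set M := Num.sqrt _ => wM.
have epsE : Num.sqrt n%:R * M = eps by rewrite /eps noise_levelE.
have NR : 0 < N%:R :> R by rewrite ltr0n.
have l0 : 0 < ln (2 * n%:R * T%:R / delta).
  have /andP[d0 d1] := d01; rewrite ln_gt0 // ltr_pdivlMr // mul1r.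
  by apply: lt_le_trans d1 _; rewrite -mulrA mulr_ege1 ?mulr_ege1 ?ler1n.
have rad0 :
    0 < 2 * sigma ^+ 2 * n%:R * T%:R / N%:R * ln (2 * n%:R * T%:R / delta).
  by rewrite !mulr_gt0 ?exprn_gt0 ?invr_gt0 ?ltr0n.
have e0 : 0 < eps by rewrite /eps /noise_level sqrtr_gt0.
have M0 : 0 <= M by exact: sqrtr_ge0.
have G0 : 0 <= normG by exact: specnorm_ge0.
have NT0 : 0 <= normT by exact: specnorm_ge0.
have eps2 : eps ^+ 2 * Num.max (9 * L%:R * normG ^+ 2)
  (4 * normG ^+ 2 * normT ^+ 2) <= 1.
  rewrite /eps /noise_level (sqr_sqrtr (ltW rad0)).
  rewrite -(ler_pM2r NR) mul1r; apply: le_trans Nlarge.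
  rewrite le_eqVlt; apply/orP; left; apply/eqP.
  set mx := Num.max _ _; set l := ln _; field; by rewrite gt_eqF.
have rho_le : eps * normT * normG <= 1 / 2.
  rewrite -(@ler_pXn2r _ 2) ?nnegrE ?mulr_ge0 ?(ltW e0) ?invr_ge0 //.
  have : eps ^+ 2 * (4 * normG ^+ 2 * normT ^+ 2) <= 1.
    by apply: le_trans eps2; rewrite ler_pM2l ?exprn_gt0 // le_max lexx orbT.
  by rewrite !exprMn; lra.
have beta_le : Num.sqrt L%:R * eps * normG <= 1 / 3.
  rewrite -(@ler_pXn2r _ 2) ?nnegrE ?mulr_ge0 ?sqrtr_ge0 ?(ltW e0) ?invr_ge0 //.
  have : eps ^+ 2 * (9 * L%:R * normG ^+ 2) <= 1.
    by apply: le_trans eps2; rewrite ler_pM2l ?exprn_gt0 // le_max lexx.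
  by rewrite !exprMn (sqr_sqrtr (ler0n _ L)); lra.
have [GsP PhixE PhiuE] := par.
have sE : xbar om = state A B 0 u wb.
  by apply/funext => t; rewrite /xbar average_state.
have JE : Jstar = response_cost Q Rm Phixs Phius.
  by have [ach _] := opt; exact: optimal_cost_response ach par.
have J0 : 0 <= Jstar by rewrite JE response_cost_ge0.
pose cand := candidate A B wb Gs.
pose rho := eps * normT * normG; pose beta := Num.sqrt L%:R * eps * normG.
pose q := eps * normG * normT * L%:R * (1 + specnorm (obsmx L A))
  * frobnorm (psdsqrt Q).
have feas : robust_feasible (xbar om) eps (beta / (1 - rho)) cand.
  rewrite sE /rho /beta -epsE; apply: (candidate_feasible (M := M));
    rewrite ?epsE //.
have obj : robust_objective Q Rm (xbar om) u (beta / (1 - rho)) cand <=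
    (Jstar + q) / (1 - rho - beta).
  rewrite JE PhixE PhiuE sE /q /rho /beta -epsE.
  by apply: candidate_objective; rewrite ?epsE.
have hank : specnorm (hankel T L wb) <= eps.
  by rewrite -epsE; exact: specnorm_hankel_small L0 LleT M0 wM.
split.
  have [Q0|Q0] := eqVneq (psdsqrt Q) 0; last first.
    exact: robust_optimal_exists feas.
  (* [Jstar] and [q] vanish, so the candidate has objective [0] *)
  exists (beta / (1 - rho)), cand; split => // gam' G' feas'.
  apply: le_trans (robust_objective_ge0 _ _ _ feas').
  apply: le_trans obj _; rewrite JE (optimal_cost_eq0 L0 Q0 opt).
  by rewrite /q Q0 frobnorm0 mulr0 addr0 mul0r.
move=> gam G [Gfeas Gopt]; cbv zeta.
set Jhat := LQG_cost _ _ _ _ (synthesized _ _ _).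
have hat : Jhat <= (Jstar + q) / (1 - rho - beta).
  apply: le_trans obj; apply: le_trans (Gopt _ _ feas).
  rewrite /Jhat sE; rewrite sE in Gfeas.
  exact: (robust_cost_le _ _ L0 e0 (fun t => erefl) hank Gfeas).
rewrite -[Num.sqrt (_ * ln _)]/eps.
have q0 : 0 <= q.
  by rewrite /q !mulr_ge0 ?addr_ge0 ?specnorm_ge0 ?frobnorm_ge0 ?(ltW e0).
have rho0 : 0 <= rho by rewrite /rho !mulr_ge0 ?(ltW e0).
have beta0 : 0 <= beta by rewrite /beta !mulr_ge0 ?sqrtr_ge0 ?(ltW e0).
have [Jp|] := ltP 0 Jstar.
  apply: le_trans (relative_gap Jp q0 rho0 beta0 rho_le beta_le hat) _.
  by rewrite le_eqVlt; apply/orP; left; apply/eqP; rewrite /q /rho /beta;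
    field; rewrite gt_eqF.
(* for [Jstar = 0] the left-hand side is [0], as division by [0] gives [0] *)
move=> Jn; have -> : Jstar = 0 by apply/eqP; rewrite eq_le Jn J0.
rewrite invr0 !mulr0 addr0 mulr1.
by rewrite !mulr_ge0 ?addr_ge0 ?mulr_ge0 ?sqrtr_ge0 ?(ltW e0).
Qed.
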